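(* Let $\Omega\subset\mathbb{R}^n$ be a domain with boundary of class $C^2$ satisfying a uniform interior sphere condition. Then $\mu:=(-\Delta d)\,dx$ (the distributional Laplacian of $d$ with a minus sign) is a signed Radon measure on $\Omega$. Moreover, if $\mu=\mu_{ac}+\mu_s$ is the Lebesgue decomposition of $\mu$ with respect to Lebesgue measure $\mathcal{L}^n$ (i.e. $\mu_{ac}\ll\mathcal{L}^n$ and $\mu_s\perp\mathcal{L}^n$), then $\mu_s\ge0$ in $\Omega$, and $\mu_{ac}\ge (n-1)\underline{\mathcal{H}}\,dx$ a.e. in $\Omega$, where $\underline{\mathcal{H}}:=\inf_{y\in\partial\Omega}\mathcal{H}(y)$.
   Context: $d(x):=\operatorname{dist}(x,\mathbb{R}^n\setminus\Omega)$. A domain is an open connected set. $\Omega$ satisfies a uniform interior sphere condition if there is $r>0$ such that for every $y\in\partial\Omega$ there is an open ball of radius $r$ contained in $\Omega$ whose boundary contains $y$. $\mathcal{H}(y):=\frac{1}{n-1}\sum_{i=1}^{n-1}\kappa_i(y)$ is the mean curvature of $\partial\Omega$ at $y$, where $\kappa_i(y)$ are the principal curvatures with the sign convention that the boundary sphere of a ball of radius $R$ has all principal curvatures equal to $1/R$. *)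

(* Defs.v *)
From HB Require Import structures.
From mathcomp Require Import all_boot all_order all_algebra.
From mathcomp Require Import all_classical all_reals all_analysis.
Set Implicit Arguments. Unset Strict Implicit. Unset Printing Implicit Defensive.
Import Order.TTheory GRing.Theory Num.Theory.
Import numFieldNormedType.Exports.
Local Open Scope classical_set_scope.
Local Open Scope ring_scope.

Section Defs.
Variables (R : realType) (n : nat).
Local Notation V := 'rV[R]_n.

Definition enorm (x : V) : R := Num.sqrt (\sum_(i < n) x 0 i ^+ 2).
Definition eball (c : V) (r : R) : set V := [set x | enorm (x - c) < r].

Definition distc (Om : set V) (x : V) : R := inf [set enorm (x - y) | y in ~` Om].

Definition bdry (Om : set V) : set V := closure Om `\` interior Om.

Definition evec (i : 'I_n) : V := delta_mx 0 i.
Definition partial (i : 'I_n) (f : V -> R) : V -> R := fun x => 'D_(evec i) f x.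
Definition dpart (s : seq 'I_n) (f : V -> R) : V -> R := foldr partial f s.

Definition C2_on (U : set V) (f : V -> R) : Prop :=
  {within U, continuous f} /\
  (forall i, (forall x, U x -> derivable f x (evec i)) /\ {within U, continuous (partial i f)}) /\
  (forall i j, (forall x, U x -> derivable (partial i f) x (evec j)) /\
               {within U, continuous (partial j (partial i f))}).

Definition smooth (f : V -> R) : Prop :=
  forall s : seq 'I_n, continuous (dpart s f) /\
                      forall i x, derivable (dpart s f) x (evec i).

Definition test_fun (Om : set V) (phi : V -> R) : Prop :=
  smooth phi /\ exists K : set V, [/\ compact K, K `<=` Om & forall x, ~ K x -> phi x = 0].

Definition laplacian (f : V -> R) : V -> R := fun x => \sum_(i < n) dpart [:: i; i] f x.

Definition local_defining (Om : set V) (y : V) (r : R) (psi : V -> R) : Prop :=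
  [/\ 0 < r, C2_on (eball y r) psi,
      (exists i, partial i psi y != 0) &
      forall x, eball y r x -> (Om x <-> psi x < 0)].

(* Mean curvature at y computed from a local defining function psi (outer normal
   grad psi/|grad psi|): the sum of principal curvatures (= trace of the second
   fundamental form, i.e. of the Hessian of psi/|grad psi| restricted to the
   tangent space) divided by (n-1). With this sign convention the sphere of
   radius R has all principal curvatures 1/R. *)
Definition mean_curv_formula (psi : V -> R) (y : V) : R :=
  let g i := partial i psi y in
  let h i j := partial j (partial i psi) y in
  let ng2 := \sum_(i < n) g i ^+ 2 in
  ((\sum_(i < n) h i i - (\sum_(i < n) \sum_(j < n) g i * g j * h i j) / ng2)
     / Num.sqrt ng2) / (n.-1)%:R.

Definition is_mean_curv (Om : set V) (y : V) (H : R) : Prop :=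
  exists r psi, local_defining Om y r psi /\ H = mean_curv_formula psi y.

Definition inf_mean_curv (Om : set V) : \bar R :=
  ereal_inf [set H%:E | H in [set H | exists2 y, bdry Om y & is_mean_curv Om y H]].

Definition C2_boundary (Om : set V) : Prop :=
  forall y, bdry Om y -> exists r psi, local_defining Om y r psi.

Definition uniform_interior_sphere (Om : set V) : Prop :=
  exists2 r : R, 0 < r & forall y, bdry Om y ->
    exists c : V, eball c r `<=` Om /\ enorm (y - c) = r.

Definition domain (Om : set V) : Prop := [/\ open Om, connected Om & Om !=set0].

Definition Rn := g_sigma_algebraType (@open V).
Definition borel_disp := sigma_display (@open V).

(* lam is Lebesgue measure on Borel(R^n): it gives half-open boxes their volume
   (this characterizes it uniquely) *)
Definition is_lebesgue (lam : {measure set Rn -> \bar R}) : Prop :=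
  forall a b : V, (forall i, a 0 i <= b 0 i) ->
    lam ([set x : V | forall i, a 0 i <= x 0 i < b 0 i] : set Rn)
      = (\prod_(i < n) (b 0 i - a 0 i))%:E.

Definition loc_finite_on (Om : set V) (m : {measure set Rn -> \bar R}) : Prop :=
  m (~` Om : set Rn) = 0%E /\
  forall K : set V, compact K -> K `<=` Om -> (m (K : set Rn) < +oo)%E.

(* relatively compact Borel subsets of Om (where a signed Radon measure is defined) *)
Definition rc_borel (Om : set V) (A : set Rn) : Prop :=
  measurable A /\ exists K : set V, [/\ compact K, K `<=` Om & (A : set V) `<=` K].

Definition singular_wrt (m lam : {measure set Rn -> \bar R}) : Prop :=
  exists N : set Rn, [/\ measurable N, lam N = 0%E & m (~` N) = 0%E].

End Defs.

(* Main.v *)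
(** Let [y] be a nearest boundary point of [x] in [Om], and [d] the distance to the
    complement. Since [d <= |. - y|] with equality at [x], second differences satisfy
    [d x * (d (x + v) + d (x - v) - 2 * d x) <= |v| ^ 2], so the discrete Laplacian
    [D_t d] is at most [n / d]. Hence [psi |-> \int psi (n / d - D_t d)] is a positive
    functional on C_c(Om), bounded uniformly in [t] by discrete integration by parts
    because [d] is Lipschitz. Its limit along an ultrafilter is integration against
    a Radon measure [mup], and moving [D_t] onto test functions gives
    [- Delta d = mup - (n / d) dx].

    Pushing the boundary point [y] along a paraboloid lying just outside [Om] bounds
    [d] from above near [x] and yields [limsup D_t d x <= - (n - 1) H(y)] at every
    point. By Fatou's lemma [mup >= max (0, n / d + c) dx] with [c = (n - 1) inf H].
    Thus [mu >= c dx], and as [(n / d) dx] is absolutely continuous the singular part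
    of [mu] is that of [mup]. No second-order differentiability of [d] is used. *)
Require Import Defs.
From HB Require Import structures.
From mathcomp Require Import all_boot all_order all_algebra.
From mathcomp Require Import all_classical all_reals all_analysis.
From mathcomp Require Import measurable_realfun ring lra.
Import Order.TTheory GRing.Theory Num.Theory.
Import numFieldNormedType.Exports.
Local Open Scope classical_set_scope.
Local Open Scope ring_scope.
Set Implicit Arguments.
Unset Strict Implicit.
Unset Printing Implicit Defensive.

(** * Euclidean norm and distance to the complement *)

Section EuclideanNorm.
Context {R : realType} {n : nat}.
Local Notation V := 'rV[R]_n.
Implicit Types (x y z u v : V) (c r t : R).

(** The function [d] is only Lipschitz, so both the existence of the measure and its lower bound
    must come from one-sided information. The nearest boundary point supplies it: the distance to a
    fixed point has second differences at most [1 / d]. The constant is [n] rather than [n - 1]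
    because the [n] coordinate directions are estimated separately. The function [n / d] blows up at
    the boundary but is bounded on compact subsets of [Om], which is all that local finiteness asks.

    The ultrafilter selects limits for all continuous [psi] at once, with neither a dense family nor
    a diagonal sequence. Its choice does no harm: for test functions the whole sequence converges,
    and for the curvature bound only lower bounds are passed to the limit.

    A pointwise limsup can bound a weak limit because the discrete densities are nonnegative: mass
    that concentrates in the limit only enlarges [mup]. Conversely, once the inequality is known for
    measures, the bound on the density of any Lebesgue decomposition follows by testing on Borel
    sets that avoid a null set carrying the singular parts. *)

Definition dot u v : R := \sum_(i < n) u 0 i * v 0 i.

Lemma dotC u v : dot u v = dot v u.
Proof. by apply: eq_bigr => i _; rewrite mulrC. Qed.

Lemma dotDl u v w : dot (u + v) w = dot u w + dot v w.
Proof. by rewrite -big_split; apply: eq_bigr => i _; rewrite mxE mulrDl. Qed.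

Lemma dotZl c u v : dot (c *: u) v = c * dot u v.
Proof. by rewrite mulr_sumr; apply: eq_bigr => i _; rewrite mxE mulrA. Qed.

Lemma dotNl u v : dot (- u) v = - dot u v.
Proof. by rewrite -scaleN1r dotZl mulN1r. Qed.

Lemma dotDr u v w : dot u (v + w) = dot u v + dot u w.
Proof. by rewrite dotC dotDl !(dotC _ u). Qed.

Lemma dotZr c u v : dot u (c *: v) = c * dot u v.
Proof. by rewrite dotC dotZl (dotC v). Qed.

Lemma dotNr u v : dot u (- v) = - dot u v.
Proof. by rewrite dotC dotNl dotC. Qed.

Lemma dot_ge0 u : 0 <= dot u u.
Proof. by apply: sumr_ge0 => i _; rewrite -expr2 sqr_ge0. Qed.

Lemma enorm_sqr u : enorm u ^+ 2 = dot u u.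
Proof.
rewrite /enorm sqr_sqrtr; last by apply: sumr_ge0 => i _; rewrite sqr_ge0.
by apply: eq_bigr => i _; rewrite expr2.
Qed.

Lemma enorm_ge0 u : 0 <= enorm u.
Proof. exact: sqrtr_ge0. Qed.

Lemma enorm_eq u r : 0 <= r -> dot u u = r ^+ 2 -> enorm u = r.
Proof.
move=> r0 h; apply/eqP; rewrite -(eqrXn2 (n := 2)) ?enorm_ge0 //.
by rewrite enorm_sqr h.
Qed.

Lemma enorm_le u r : 0 <= r -> dot u u <= r ^+ 2 -> enorm u <= r.
Proof.
by move=> r0 h; rewrite -(@ler_pXn2r _ 2) ?nnegrE ?enorm_ge0 // enorm_sqr.
Qed.

Lemma enormZ c u : enorm (c *: u) = `|c| * enorm u.
Proof.
apply: enorm_eq; first by rewrite mulr_ge0 ?enorm_ge0.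
by rewrite exprMn enorm_sqr real_normK ?num_real // dotZl dotZr mulrA expr2.
Qed.

Lemma enormN u : enorm (- u) = enorm u.
Proof. by rewrite -scaleN1r enormZ normrN1 mul1r. Qed.

Lemma enormB u v : enorm (u - v) = enorm (v - u).
Proof. by rewrite -enormN opprB. Qed.

Lemma enorm0 : enorm (0 : V) = 0.
Proof. by rewrite -(scale0r 0) enormZ normr0 mul0r. Qed.

Lemma coord_le_enorm u i : `|u 0 i| <= enorm u.
Proof.
rewrite -(@ler_pXn2r _ 2) ?nnegrE ?enorm_ge0 // enorm_sqr.
rewrite real_normK ?num_real // /dot (bigD1 i) //= -expr2 lerDl.
by apply: sumr_ge0 => j _; rewrite -expr2 sqr_ge0.
Qed.

Lemma enorm_eq0 u : enorm u = 0 -> u = 0.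
Proof.
move=> h; apply/rowP => i; rewrite mxE; apply/eqP; by rewrite -normr_le0 -h coord_le_enorm.
Qed.

(** Cauchy-Schwarz: the square of [|v| u - |u| v] is [2 |u| |v|] times the difference of the two
    sides. Zero vectors are treated apart because that factor is cancelled. *)
Lemma dot_le_enorm u v : dot u v <= enorm u * enorm v.
Proof.
have [/enorm_eq0 -> | u0] := eqVneq (enorm u) 0.
  by rewrite -(scale0r 0) dotZl enormZ mul0r normr0 !mul0r.
have [/enorm_eq0 -> | v0] := eqVneq (enorm v) 0.
  by rewrite -(scale0r 0) dotZr enormZ mul0r normr0 mul0r mulr0.
have := dot_ge0 (enorm v *: u - enorm u *: v).
rewrite !(dotDl, dotDr, dotNl, dotNr, dotZl, dotZr) -!enorm_sqr (dotC v u).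
have pu : 0 < enorm u by rewrite lt_def u0 enorm_ge0.
have pv : 0 < enorm v by rewrite lt_def v0 enorm_ge0.
have p : 0 < enorm u * enorm v by rewrite mulr_gt0.
move=> h; rewrite -subr_ge0 -(pmulr_rge0 _ p); nra.
Qed.

Lemma enormD u v : enorm (u + v) <= enorm u + enorm v.
Proof.
apply: enorm_le; first by rewrite addr_ge0 ?enorm_ge0.
rewrite !(dotDl, dotDr) -!enorm_sqr (dotC v u).
have := dot_le_enorm u v; nra.
Qed.

Lemma enorm_dist x y z : enorm (x - z) <= enorm (x - y) + enorm (y - z).
Proof. by rewrite (_ : x - z = (x - y) + (y - z)) ?enormD // addrA subrK. Qed.

Lemma dist_enorm x y : `|enorm x - enorm y| <= enorm (x - y).
Proof.
rewrite ler_norml; apply/andP; split.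
  by rewrite lerNl opprB lerBlDr enormB -{1}(subrK x y) enormD.
by rewrite lerBlDr -{1}(subrK y x) enormD.
Qed.

(** The topology of [V] is that of the max norm. This bound and the crude converse [enorm_le_mxnorm]
    carry neighbourhoods and compactness over to the Euclidean norm. *)
Lemma mxnorm_le_enorm u : `|u| <= enorm u.
Proof.
rewrite [leLHS]mx_normrE; apply/bigmax_leP; split; first exact: enorm_ge0.
by move=> [i j] _ /=; rewrite (ord1 i) coord_le_enorm.
Qed.

Lemma coord_le_mxnorm u i : `|u 0 i| <= `|u|.
Proof. by rewrite [leRHS]mx_normrE (le_bigmax _ (fun ij => `|u ij.1 ij.2|) (0, i)). Qed.

Lemma enorm_le_mxnorm u : enorm u <= n%:R * `|u|.
Proof.
apply: enorm_le; first by rewrite mulr_ge0.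
apply: (@le_trans _ _ (\sum_(i < n) `|u| ^+ 2)).
  apply: ler_sum => i _; rewrite -expr2 -real_normK ?num_real //.
  by rewrite lerXn2r ?nnegrE ?coord_le_mxnorm.
rewrite sumr_const card_ord exprMn -[leLHS]mulr_natl ler_wpM2r ?sqr_ge0 //.
by rewrite expr2 -natrM ler_nat; case: n => // m; rewrite leq_pmulr.
Qed.

Lemma lip_continuous (f : V -> R) c :
  (forall x y, `|f x - f y| <= c * enorm (x - y)) -> continuous f.
Proof.
move=> fl x; apply/(@cvgrPdist_lt _ _ _ (nbhs (x : V))) => e e0.
(* The added ones keep [M] positive when [c] or [n] vanishes, so that dividing by it is
   legitimate. *)
pose M := (`|c| + 1) * (n%:R + 1).
have M0 : 0 < M by rewrite mulr_gt0 // ltr_wpDl.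
near=> y.
apply: (@le_lt_trans _ _ (M * `|x - y|)).
  apply: le_trans (fl _ _) _; apply: (@le_trans _ _ (`|c| * (n%:R * `|x - y|))).
    apply: (@le_trans _ _ (`|c| * enorm (x - y))).
      by rewrite ler_wpM2r ?enorm_ge0 ?ler_norm.
    by rewrite ler_wpM2l ?enorm_le_mxnorm.
  by rewrite /M; have := normr_ge0 c; have := normr_ge0 (x - y); have := ler0n R n; nra.
rewrite -ltr_pdivlMl // mulrC.
near: y; apply: cvgr_dist_lt => //; by rewrite divr_gt0.
Unshelve. all: by end_near. Qed.

Lemma enorm_continuous : continuous (@enorm R n).
Proof. by apply: (@lip_continuous _ 1) => x y; rewrite mul1r dist_enorm. Qed.

Lemma near_eball x r : 0 < r -> \forall y \near x, enorm (y - x) < r.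
Proof.
move=> r0; near=> y.
apply: le_lt_trans (enorm_le_mxnorm _) _.
apply: (@le_lt_trans _ _ ((n%:R + 1) * `|y - x|)).
  by rewrite ler_wpM2r // lerDl.
rewrite -ltr_pdivlMl ?ltr_wpDl // distrC mulrC.
by near: y; apply: cvgr_dist_lt => //; rewrite divr_gt0 // ltr_wpDl.
Unshelve. all: by end_near. Qed.

Lemma nbhs_eball x (A : set V) :
  nbhs x A -> exists2 r, 0 < r & forall y, enorm (y - x) < r -> A y.
Proof.
move=> /nbhs_ballP[r /= r0 rA]; exists r => // y yx; apply: rA.
rewrite -ball_normE /= distrC; exact: le_lt_trans (mxnorm_le_enorm _) yx.
Qed.

Lemma open_eball x r : open (eball x r).
Proof.
rewrite openE => y /= yx; rewrite /interior.
have r0 : 0 < r - enorm (y - x) by rewrite subr_gt0.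
apply: (@filterS _ (nbhs (y : V)) _ _ _ _ (near_eball y r0)) => z zy.
rewrite /eball /=; apply: le_lt_trans (enorm_dist _ y _) _; lra.
Unshelve. all: by end_near. Qed.

Lemma bounded_compact (A : set V) r :
  closed A -> (forall x, A x -> enorm x <= r) -> compact A.
Proof.
move=> cA Ar; apply: bounded_closed_compact cA.
exists r; split; first exact: num_real.
move=> M rM x Ax; apply: le_trans (mxnorm_le_enorm _) _.
exact: le_trans (Ar _ Ax) (ltW rM).
Qed.

Lemma compact_enorm (A : set V) :
  compact A -> exists2 r, 0 < r & forall x, A x -> enorm x <= r.
Proof.
move=> /compact_bounded[M [_ AM]].
exists (n%:R * (`|M| + 1) + 1); first by rewrite ltr_wpDl // mulr_ge0 // addr_ge0.
move=> x Ax; apply: le_trans (enorm_le_mxnorm _) _.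
rewrite ler_wpDr // ler_wpM2l //; apply: AM Ax.
by rewrite (le_lt_trans (ler_norm _)) // ltrDl.
Qed.

End EuclideanNorm.

(** * Distance to the complement: nearest points and second differences *)

Section DistanceToComplement.
Context {R : realType} {n : nat}.
Local Notation V := 'rV[R]_n.
Variable Om : set V.
Hypothesis cOm0 : ~` Om !=set0.
Implicit Types (x y z v : V).
Local Notation d := (distc Om).

Lemma distc_has_inf x : has_inf [set enorm (x - y) | y in ~` Om].
Proof.
split; first by case: cOm0 => y yO; exists (enorm (x - y)), y.
by exists 0 => _ [y _ <-]; exact: enorm_ge0.
Qed.

Lemma distc_le x y : ~ Om y -> d x <= enorm (x - y).
Proof. by move=> yO; apply: ge_inf; [case: (distc_has_inf x) | exists y]. Qed.

Lemma le_distc x c : (forall y, ~ Om y -> c <= enorm (x - y)) -> c <= d x.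
Proof.
move=> h; apply: lb_le_inf; first by case: (distc_has_inf x).
by move=> _ [y yO <-]; exact: h.
Qed.

Lemma distc_ge0 x : 0 <= d x.
Proof. by apply: le_distc => y _; exact: enorm_ge0. Qed.

Lemma distc_out x : ~ Om x -> d x = 0.
Proof.
move=> xO; apply/eqP; rewrite eq_le distc_ge0 andbT.
by have := distc_le x xO; rewrite subrr enorm0.
Qed.

Lemma distc_lip x y : `|d x - d y| <= enorm (x - y).
Proof.
suff h a b : d a - d b <= enorm (a - b).
  by rewrite ler_norml h andbT lerNl opprB enormB h.
rewrite lerBlDr -lerBlDl; apply: le_distc => z zO.
by rewrite lerBlDl (le_trans (distc_le a zO)) // enorm_dist.
Qed.

Lemma distc_continuous : continuous d.
Proof. by apply: (@lip_continuous _ _ _ 1) => x y; rewrite mul1r distc_lip. Qed.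

Hypothesis oOm : open Om.

(** The points of the complement within [d x + 1] of [x] form a nonempty compact set, and all others
    are too far to compete. *)
Lemma distc_attained x : exists2 y, ~ Om y & d x = enorm (x - y).
Proof.
have cl : closed (~` Om) by exact: open_closedC.
pose B := [set y : V | enorm (x - y) <= d x + 1].
have cB : closed B.
  apply: (@closed_comp _ _ (fun y : V => enorm (x - y)) [set r | r <= d x + 1]).
    move=> y _; apply: continuous_comp; last exact: enorm_continuous.
    by apply: continuousB; [exact: cst_continuous | by move=> z; exact: cvg_id].
  exact: closed_le.
have cpt : compact (~` Om `&` B).
  apply: (@bounded_compact _ _ _ (enorm x + (d x + 1))); first exact: closedI.
  move=> y [_ /= yB]; have := enormD x (y - x); rewrite addrC subrK => h.
  by apply: le_trans h _; rewrite lerD2l enormB.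
have ne : (~` Om `&` B) !=set0.
  have [_ [y yO <-] yd] : exists2 e, [set enorm (x - y) | y in ~` Om] e & e < d x + 1.
    by apply: inf_adherent => //; exact: distc_has_inf.
  by exists y; split => //; exact: ltW.
have [|y yB ymin] := @compact_EVT_min _ _ (fun y => enorm (x - y)) _ ne cpt.
  apply: continuous_subspaceT => y; apply: continuous_comp; last exact: enorm_continuous.
  by apply: continuousB; [exact: cst_continuous | by move=> z; exact: cvg_id].
move: yB; rewrite inE => -[yO yd].
exists y => //; apply/eqP; rewrite eq_le distc_le //=.
apply: le_distc => z zO.
have [zB|zB] := leP (enorm (x - z)) (d x + 1); first by apply: ymin; rewrite inE.
by apply: le_trans yd (ltW _).
Qed.

Lemma distc_gt0 x : Om x -> 0 < d x.
Proof.
move=> xO; rewrite lt_def distc_ge0 andbT; apply/eqP => d0.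
have [y yO] := distc_attained x.
by rewrite d0 => /esym /enorm_eq0 /subr0_eq xy; apply: yO; rewrite -xy.
Qed.

Lemma distc_gt0E x : 0 < d x -> Om x.
Proof. by move=> dx; apply: contrapT => /distc_out xO; rewrite xO ltxx in dx. Qed.

Lemma eball_distc x : eball x (d x) `<=` Om.
Proof.
move=> y /= yx; apply: contrapT => yO.
by have := distc_le x yO; rewrite enormB leNgt yx.
Qed.

(** The segment from [y] to [x] enters the ball of radius [d x] about [x] at once, so [y] is a limit
    of points of [Om]. *)
Lemma nearest_bdry x y : Om x -> ~ Om y -> d x = enorm (x - y) -> bdry Om y.
Proof.
move=> xO yO dxy; split; last by move=> /interior_subset.
move=> B /nbhs_eball[r r0 rB].
have d0 := distc_gt0 xO.
pose t := Num.min (r / (2 * d x)) 1.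
have t0 : 0 < t by rewrite lt_min ltr01 andbT divr_gt0 // mulr_gt0.
have t1 : t <= 1 by rewrite ge_min lexx orbT.
exists (y + t *: (x - y)); split.
  apply: (@eball_distc x); rewrite /eball /=.
  have -> : y + t *: (x - y) - x = (t - 1) *: (x - y).
    by apply/rowP => i; rewrite !mxE; ring.
  rewrite enormZ -dxy ler0_norm ?subr_le0 // opprB; nra.
apply: rB; rewrite addrC addKr enormZ -dxy gtr0_norm //.
have : t <= r / (2 * d x) by rewrite ge_min lexx.
rewrite ler_pdivlMr ?mulr_gt0 //; nra.
Qed.

(** Squared distances to [y] have an exact second difference by the parallelogram law. The
    inequality [2 d(x) d(x + w) <= |x + w - y|^2 + d(x)^2], an equality at [w = 0], passes from
    distances to their squares. *)
Lemma distc_second_difference x v :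
  d x * (d (x + v) + d (x - v) - 2 * d x) <= enorm v ^+ 2.
Proof.
have [y yO dxy] := distc_attained x.
have [d0|d0] := eqVneq (d x) 0; first by rewrite d0 mul0r sqr_ge0.
have dp : 0 < d x by rewrite lt_def d0 distc_ge0.
have amgm w : 2 * d x * d (x + w) <= enorm (x + w - y) ^+ 2 + d x ^+ 2.
  have := distc_le (x + w) yO; have := enorm_ge0 (x + w - y).
  have := sqr_ge0 (enorm (x + w - y) - d x); nra.
have := amgm v; have := amgm (- v).
have -> : x + v - y = (x - y) + v by rewrite addrAC.
have -> : x - v - y = (x - y) - v by rewrite addrAC.
move: (x - y) dxy => u dxy.
rewrite dxy !enorm_sqr !(dotDl, dotDr, dotNl, dotNr) -!enorm_sqr (dotC v); nra.
Qed.

End DistanceToComplement.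

(** * Compactly supported functions and the Riesz representation theorem *)

Section CompactlySupported.
Context {R : realType} {n : nat}.
Local Notation V := 'rV[R]_n.
Implicit Types (Om U K : set V) (f g : V -> R) (c : R).

Definition Cc Om f : Prop :=
  continuous f /\ exists K, [/\ compact K, K `<=` Om & forall x, ~ K x -> f x = 0].

Lemma continuous_addr f g :
  continuous f -> continuous g -> continuous (fun x => f x + g x).
Proof. by move=> cf cg x; apply: (@continuousD R R^o V f g); [exact: cf | exact: cg]. Qed.

Lemma continuous_subr f g :
  continuous f -> continuous g -> continuous (fun x => f x - g x).
Proof. by move=> cf cg x; apply: (@continuousB R R^o V f g); [exact: cf | exact: cg]. Qed.

Lemma continuous_mulr f g :
  continuous f -> continuous g -> continuous (fun x => f x * g x).
Proof. by move=> cf cg x; apply: (@continuousM R V f g); [exact: cf | exact: cg]. Qed.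

Lemma continuous_cst c : continuous (fun _ : V => c).
Proof. by move=> x; exact: cst_continuous. Qed.

Lemma Cc_sub Om f g :
  Cc Om f -> continuous g -> (forall x, f x = 0 -> g x = 0) -> Cc Om g.
Proof.
by move=> [_ [K [cK KO K0]]] cg fg; split => //; exists K; split => // x /K0 /fg.
Qed.

Lemma CcZ Om c f : Cc Om f -> Cc Om (fun x => c * f x).
Proof.
move=> fC; apply: (Cc_sub fC) => [|x ->]; last by rewrite mulr0.
by apply: continuous_mulr; [exact: continuous_cst | exact: fC.1].
Qed.

Lemma CcD Om f g : Cc Om f -> Cc Om g -> Cc Om (fun x => f x + g x).
Proof.
move=> [cf [K [cK KO K0]]] [cg [L [cL LO L0]]]; split.
  exact: continuous_addr.
exists (K `|` L); split; first exact: compactU.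
  by move=> x [/KO|/LO].
by move=> x /not_orP[/K0 -> /L0 ->]; rewrite addr0.
Qed.

Lemma CcB Om f g : Cc Om f -> Cc Om g -> Cc Om (fun x => f x - g x).
Proof.
move=> fC /(CcZ (-1)) gC; have := CcD fC gC.
by congr Cc; apply/funext => x; rewrite mulN1r.
Qed.

Lemma CcM Om f g : Cc Om f -> continuous g -> Cc Om (fun x => f x * g x).
Proof.
move=> fC cg; apply: (Cc_sub fC) => [|x ->]; last by rewrite mul0r.
exact: continuous_mulr fC.1 cg.
Qed.

Lemma continuous_maxr f g :
  continuous f -> continuous g -> continuous (fun x => Num.max (f x) (g x)).
Proof.
by move=> cf cg x; apply: (@continuous_max R _ f g); [exact: cf | exact: cg].
Qed.

Lemma continuous_minr f g :
  continuous f -> continuous g -> continuous (fun x => Num.min (f x) (g x)).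
Proof.
move=> cf cg; rewrite (_ : (fun _ => _) = (fun x => - Num.max (- f x) (- g x))).
  move=> x; apply: (@continuousN R R^o V (fun x => Num.max (- f x) (- g x))).
  by apply: continuous_maxr => y; apply: (@continuousN R R^o V); [exact: cf | exact: cg].
by apply/funext => x; rewrite oppr_max !opprK.
Qed.

Lemma Cc_max0 Om f : Cc Om f -> Cc Om (fun x => Num.max (f x) 0).
Proof.
move=> fC; apply: (Cc_sub fC) => [|x ->]; last by rewrite maxxx.
by apply: continuous_maxr; [exact: fC.1 | exact: cst_continuous].
Qed.

Lemma Cc_bounded Om f : Cc Om f -> exists2 c, 0 < c & forall x, `|f x| <= c.
Proof.
move=> [cf [K [cK KO K0]]].
have /compact_bounded[M [_ fM]] : compact (f @` K).
  by apply: continuous_compact => //; exact: continuous_subspaceT.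
exists (`|M| + 1); first by rewrite ltr_wpDl.
move=> x; have [xK|xK] := pselect (K x).
  by apply: (fM (`|M| + 1)); [rewrite (le_lt_trans (ler_norm _)) ?ltrDl | exists x].
by rewrite K0 // normr0 addr_ge0.
Qed.

Lemma closed_compact_superlevel Om f c :
  Cc Om f -> 0 < c -> compact [set x | c <= f x].
Proof.
move=> [cf [K [cK KO K0]]] c0; apply: (subclosed_compact _ cK).
  apply: (@closed_comp _ _ f [set r | c <= r]) => [x _|]; first exact: cf.
  exact: closed_ge.
by move=> x /= cx; apply: contrapT => /K0 fx; rewrite fx leNgt c0 in cx.
Qed.

Lemma open_superlevel f c : continuous f -> open [set x | c < f x].
Proof.
move=> cf; apply: (@open_comp _ _ f [set r | c < r]) => [x _|]; first exact: cf.
exact: open_gt.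
Qed.

Definition lipschitz_const c f := forall x y, `|f x - f y| <= c * enorm (x - y).

Lemma lip_max c f g : lipschitz_const c f -> lipschitz_const c g ->
  lipschitz_const c (fun x => Num.max (f x) (g x)).
Proof.
move=> lf lg x y; have := lf x y; have := lg x y; rewrite !ler_norml.
move=> /andP[a1 a2] /andP[b1 b2]; rewrite maxEle [Num.max (f y) _]maxEle.
by case: ifPn; case: ifPn; rewrite -?ltNge; lra.
Qed.

Lemma lip_min c f g : lipschitz_const c f -> lipschitz_const c g ->
  lipschitz_const c (fun x => Num.min (f x) (g x)).
Proof.
move=> lf lg x y; have := lf x y; have := lg x y; rewrite !ler_norml.
move=> /andP[a1 a2] /andP[b1 b2]; rewrite minEle [Num.min (f y) _]minEle.
by case: ifPn; case: ifPn; rewrite -?ltNge; lra.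
Qed.

Lemma lip_cst c r : 0 <= c -> lipschitz_const c (fun=> r).
Proof. by move=> c0 x y; rewrite subrr normr0 mulr_ge0 ?enorm_ge0. Qed.

(** The Lipschitz constant is recorded because discrete integration by parts bounds the
    approximating functionals through it. *)
Lemma cutoff Om K : open Om -> ~` Om !=set0 -> compact K -> K `<=` Om ->
  exists chi c, [/\ Cc Om chi, forall x, 0 <= chi x <= 1,
    forall x, K x -> chi x = 1, 0 <= c & lipschitz_const c chi].
Proof.
move=> oO nO cK KO.
have [r r0 Kr] := compact_enorm cK.
have [e e0 Ke] : exists2 e, 0 < e & forall x, K x -> 2 * e <= distc Om x.
  have [K0|/set0P K0] := eqVneq K set0; first by exists 1 => // x; rewrite K0.
  have [|x xK xm] := @compact_EVT_min _ _ (distc Om) _ K0 cK.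
    by apply: continuous_subspaceT; exact: distc_continuous.
  rewrite inE in xK; exists (distc Om x / 2).
    by rewrite divr_gt0 // distc_gt0 //; exact: KO.
  by move=> y yK; rewrite mulrC divfK ?pnatr_eq0 // xm // inE.
(* The first term is at least 1 on [K], where [d >= 2 e], and nonpositive where [d <= e]. The second
   confines the support to a ball, since [Om] may be unbounded. *)
pose h x := Num.min (distc Om x / e - 1) (r + 2 - enorm x).
pose chi x := Num.max 0 (Num.min 1 (h x)).
pose c := e^-1 + 1.
have c0 : 0 <= c by rewrite addr_ge0 // invr_ge0 ltW.
have lc : lipschitz_const c chi.
  apply: lip_max; first exact: lip_cst.
  apply: lip_min; first exact: lip_cst.
  apply: lip_min => x y.
    rewrite (_ : _ - _ = (distc Om x - distc Om y) / e); last by ring.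
    rewrite normrM (gtr0_norm (_ : 0 < e^-1)) ?invr_gt0 // mulrC.
    apply: ler_pM; rewrite ?invr_ge0 ?(ltW e0) //; last exact: distc_lip.
    by rewrite lerDl.
  rewrite (_ : _ - _ = enorm y - enorm x); last by ring.
  apply: le_trans (dist_enorm _ _) _; rewrite enormB.
  by rewrite -[leLHS]mul1r ler_wpM2r ?enorm_ge0 // lerDr invr_ge0 ltW.
exists chi, c; split => //.
- split; first exact: lip_continuous lc.
  exists [set x | e <= distc Om x /\ enorm x <= r + 2]; split.
  + apply: (@bounded_compact _ _ _ (r + 2)); last by move=> x [].
    apply: closedI.
      apply: (@closed_comp _ _ (distc Om) [set s | e <= s]) => [x _|].
        exact: distc_continuous.
      exact: closed_ge.
    apply: (@closed_comp _ _ (@enorm R n) [set s | s <= r + 2]) => [x _|].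
      exact: enorm_continuous.
    exact: closed_le.
  + by move=> x [ex _]; apply: distc_gt0E => //; exact: lt_le_trans ex.
  + move=> x /not_andP xn; rewrite /chi; apply: max_l; rewrite ge_min.
    apply/orP; right; rewrite /h ge_min subr_le0 subr_le0.
    case: xn => /negP; rewrite -ltNge => h'.
      by rewrite ler_pdivrMr // mul1r ltW.
    by rewrite (ltW h') orbT.
- move=> x; rewrite le_max lexx /= ge_max ler01 /=.
  by rewrite ge_min lexx.
- move=> x xK; rewrite /chi (min_l (_ : 1 <= _)); first by rewrite max_r.
  rewrite le_min; apply/andP; split; last by have := Kr _ xK; lra.
  by rewrite lerBrDr ler_pdivlMr // Ke.
Qed.

Lemma measurable_open U : open U -> measurable (U : set (Rn R n)).
Proof. by move=> oU; apply: sub_sigma_algebra. Qed.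

Lemma measurable_closed U : closed U -> measurable (U : set (Rn R n)).
Proof.
by move=> cU; rewrite -[U]setCK; apply: measurableC; apply: measurable_open; exact: closed_openC.
Qed.

Lemma measurable_compact K : compact K -> measurable (K : set (Rn R n)).
Proof. by move=> cK; apply: measurable_closed; apply: compact_closed. Qed.

Lemma measurable_continuous f :
  continuous f -> measurable_fun setT (f : Rn R n -> R).
Proof.
move=> cf; apply: (measurability _ (measurable_realfun.RGenOpens.measurableE R)) => _ [_ [a [b ->]] <-].
rewrite setTI; apply: measurable_open.
by apply: open_comp => [x _|]; [exact: cf | exact: interval_open].
Qed.

Lemma Cc_integrable (m : {measure set (Rn R n) -> \bar R}) Om f :
  (forall K, compact K -> K `<=` Om -> (m K < +oo)%E) -> Cc Om f ->
  m.-integrable setT (EFin \o f).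
Proof.
move=> mfin fC; have [c c0 fc] := Cc_bounded fC.
have [cf [K [cK KO K0]]] := fC.
have mK := measurable_compact cK.
rewrite (_ : EFin \o f = (EFin \o f) \_ K).
  apply: (iffLR (integrable_mkcond _ mK)); apply: measurable_bounded_integrable => //.
  - exact: mfin.
  - by apply: measurable_funS (measurable_continuous cf).
  exists c; split; first exact: num_real.
  by move=> M cM x _; apply: le_trans (fc x) (ltW cM).
apply/funext => x /=; rewrite /patch; case: ifPn => // /negP xK.
by rewrite K0 // => Kx; apply: xK; rewrite inE.
Qed.

End CompactlySupported.

(** * Positive linear functionals on compactly supported functions *)

Section PositiveFunctional.
Context {R : realType} {n : nat}.
Local Notation V := 'rV[R]_n.
Variable Om : set V.
Implicit Types (f g : V -> R) (L : (V -> R) -> R).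

Definition positive_linear L : Prop :=
  [/\ forall f g, Cc Om f -> Cc Om g -> L (fun x => f x + g x) = L f + L g,
      forall c f, Cc Om f -> L (fun x => c * f x) = c * L f &
      forall f, Cc Om f -> (forall x, 0 <= f x) -> 0 <= L f].

Lemma positive_linearB L f g : positive_linear L -> Cc Om f -> Cc Om g ->
  L (fun x => f x - g x) = L f - L g.
Proof.
move=> [LD LZ _] fC gC.
rewrite (_ : (fun x => f x - g x) = (fun x => f x + -1 * g x)).
  by rewrite LD ?LZ ?mulN1r //; exact: CcZ.
by apply/funext => x; rewrite mulN1r.
Qed.

Lemma le_positive_linear L f g : positive_linear L -> Cc Om f -> Cc Om g ->
  (forall x, f x <= g x) -> L f <= L g.
Proof.
move=> Lp fC gC fg; rewrite -subr_ge0 -positive_linearB //.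
by case: Lp => _ _; apply; [exact: CcB | move=> x; rewrite subr_ge0].
Qed.

Lemma Cc0 : Cc Om (fun=> 0).
Proof.
split; first exact: cst_continuous.
by exists set0; split => //; exact: compact0.
Qed.

Lemma positive_linear0 L : positive_linear L -> L (fun=> 0) = 0.
Proof.
move=> [_ LZ _]; by have := LZ 0 _ Cc0; rewrite !mul0r.
Qed.

End PositiveFunctional.

(** * The outer measure of a positive functional and its Borel restriction *)

Section Riesz.
Context {R : realType} {n : nat}.
Local Notation V := 'rV[R]_n.
Variable Om : set V.
Hypotheses (oOm : open Om) (nOm : ~` Om !=set0).
Variable L : (V -> R) -> R.
Hypothesis Lp : positive_linear Om L.
Implicit Types (f g : V -> R) (U A : set V).

(** Only vanishing off [U] is asked: the support of [f] may touch the boundary of [U]. This makes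
    memberships easy to verify, and [below_trim] recovers a compact margin when one is needed. *)
Definition below U f : Prop :=
  [/\ Cc Om f, forall x, 0 <= f x <= 1 & forall x, ~ U x -> f x = 0].

Definition mopen U : \bar R := ereal_sup [set (L f)%:E | f in below U].

(* Only [A `&` Om] is covered, so the resulting measure does not charge [~` Om]. *)
Definition mext A : \bar R :=
  ereal_inf [set mopen U | U in [set U | open U /\ A `&` Om `<=` U]].

Lemma below0 U : below U (fun=> 0).
Proof. by split => //; [exact: Cc0 | move=> x; rewrite lexx ler01]. Qed.

Lemma le_mopen U f : below U f -> ((L f)%:E <= mopen U)%E.
Proof. by move=> fU; apply: ereal_sup_ubound; exists f. Qed.

Lemma mopen_ge0 U : (0 <= mopen U)%E.
Proof. by rewrite -[0%E]/(0%:E) -(positive_linear0 Lp); exact: le_mopen (below0 U). Qed.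

Lemma mext_ge0 A : (0 <= mext A)%E.
Proof. by apply: le_ereal_inf_tmp => _ [U _ <-]; exact: mopen_ge0. Qed.

Lemma mext_le A U : open U -> A `&` Om `<=` U -> (mext A <= mopen U)%E.
Proof. by move=> oU AU; apply: ereal_inf_lbound; exists U. Qed.

(** Members of [below U] already vanish off [Om], hence belong to [below W] for every open [W]
    containing the trace of [U] on [Om]. *)
Lemma mext_open U : open U -> mext U = mopen U.
Proof.
move=> oU; apply/eqP; rewrite eq_le (mext_le oU) /=; last by move=> x [].
apply: le_ereal_inf_tmp => _ [W [oW UW] <-]; apply: ub_ereal_sup => _ [f [fC f01 fU] <-].
apply: le_mopen; split => // x xW.
have [xU|/fU//] := pselect (U x).
case: fC => _ [K [_ KO K0]]; apply: K0 => /KO xO.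
by apply: xW; apply: UW.
Qed.

Lemma mext_mono A B : A `<=` B -> (mext A <= mext B)%E.
Proof.
move=> AB; apply: le_ereal_inf => _ [U [oU BU] <-]; exists U => //; split => //.
by move=> x [/AB xB xO]; apply: BU.
Qed.

Lemma mext0 : mext set0 = 0%E.
Proof.
apply/eqP; rewrite eq_le mext_ge0 andbT mext_open; last exact: open0.
apply: ub_ereal_sup => _ [f [fC _ f0] <-].
rewrite (_ : f = (fun=> 0)) ?(positive_linear0 Lp) //.
by apply/funext => x; exact: f0.
Qed.

(** Lowering [f] by [c] and cutting at 0 confines it to the compact set where [c <= f], inside [U].
    The loss is at most [c L(chi)], which fixes [c]; the added one in its denominator covers
    [L chi = 0]. *)
Lemma below_trim U f e : below U f -> 0 < e -> exists g c,
  [/\ below U g, L f <= L g + e, 0 < c & forall x, g x != 0 -> c <= f x].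
Proof.
move=> [fC f01 fU] e0.
have [cf [K [cK KO K0]]] := fC.
have [chi [_ [chiC chi01 chi1 _ _]]] := cutoff oOm nOm cK KO.
have Lchi : 0 <= L chi by case: Lp => _ _; apply => // x; case/andP: (chi01 x).
pose c := e / (L chi + 1).
have c0 : 0 < c by rewrite divr_gt0 // ltr_wpDl.
pose g x := Num.max (f x - c) 0.
have cg : continuous g.
  apply: continuous_maxr; last exact: continuous_cst.
  exact: continuous_subr cf (@continuous_cst R n _).
have gf0 x : f x = 0 -> g x = 0.
  by move=> fx; rewrite /g fx sub0r max_r // oppr_le0 ltW.
have gC : Cc Om g by exact: Cc_sub fC cg gf0.
exists g, c; split => //.
- split => // x; last by move=> /fU /gf0.
  rewrite le_max lexx orbT /= ge_max ler01 andbT lerBlDr.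
  by case/andP: (f01 x) => _ /le_trans; apply; rewrite lerDl ltW.
- apply: (@le_trans _ _ (L (fun x => g x + c * chi x))).
    apply: (le_positive_linear Lp) => //; first by apply: CcD => //; exact: CcZ.
    move=> x; have [xK|xK] := pselect (K x).
      by rewrite chi1 // mulr1 -lerBlDr le_max lexx.
    by rewrite K0 // addr_ge0 // ?le_max ?lexx ?orbT // mulr_ge0 ?(ltW c0) //; case/andP: (chi01 x).
  case: Lp => LD LZ _; rewrite LD ?LZ //; last exact: CcZ.
  rewrite lerD2l /c mulrAC ler_pdivrMr ?ltr_wpDl //.
  by rewrite ler_wpM2l ?(ltW e0) // lerDl.
- move=> x; rewrite /g; case: (leP (f x - c) 0); first by rewrite eqxx.
  by rewrite subr_gt0 => /ltW.
Qed.

(** Distances [th k] to the complement of [U k] within [Om] serve instead of a partition of unity.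
    By compactness a multiple of a finite sum of them exceeds 1 wherever [g] is nonzero, so
    subtracting them one after another exhausts [g]. *)
Lemma mopen_bigcup (U : (set V)^nat) : (forall k, open (U k)) ->
  (mopen (\bigcup_k U k) <= \sum_(0 <= k <oo) mopen (U k))%E.
Proof.
move=> oU; apply: ub_ereal_sup => _ [f fU <-]; apply/lee_addgt0Pr => e e0.
have [g [c [gU fg c0 gc]]] := below_trim fU e0.
apply: (@le_trans _ _ (L g + e)%:E) => //; rewrite EFinD leeD2r //.
pose th k := distc (U k `&` Om).
have oUO k : open (U k `&` Om) by exact: openI.
have nUO k : ~` (U k `&` Om) !=set0.
  by case: nOm => y yO; exists y => -[_ /yO].
have th0 k x : 0 <= th k x by exact: distc_ge0.
pose S N x := \sum_(k < N) th k x.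
have SS N x : S N.+1 x = S N x + th N x by rewrite /S big_ord_recr.
have cS N : continuous (S N).
  elim: N => [|N IH].
    rewrite (_ : S 0%N = (fun=> 0)); first exact: cst_continuous.
    by apply/funext => x; rewrite /S big_ord0.
  rewrite (_ : S N.+1 = (fun x => S N x + th N x)); last by apply/funext => x; exact: SS.
  by apply: continuous_addr => //; exact: distc_continuous.
have Smono N M x : (N <= M)%N -> S N x <= S M x.
  elim: M => [|M IH]; first by rewrite leqn0 => /eqP ->.
  rewrite leq_eqVlt => /predU1P[-> //|]; rewrite ltnS => /IH h.
  by rewrite SS (le_trans h) // lerDl.
have [gC g01 gU0] := gU.
have cK : compact [set x | c <= f x] by case: fU => fC _ _; exact: closed_compact_superlevel fC c0.
have [N KN] : exists N : nat, forall x, c <= f x -> 1 <= N%:R * S N x.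
  have cK' := cK; rewrite compact_cover in cK'.
  have [||D _ KD] := cK' nat setT (fun N : nat => [set x | 1 < N%:R * S N x]).
  - move=> N _; apply: open_superlevel.
    exact: continuous_mulr (@continuous_cst R n _) (cS N).
  - move=> x /= cx; have fx0 : f x != 0 by rewrite gt_eqF // (lt_le_trans c0).
    have [k _ xUk] : (\bigcup_k U k) x.
      by apply: contrapT => xn; case: fU => _ _ /(_ _ xn) h; rewrite h eqxx in fx0.
    have xO : Om x.
      apply: contrapT => xn; case: fU => -[_ [K [_ KO K0]]] _ _.
      by rewrite K0 ?eqxx // in fx0 => /KO.
    have tk : 0 < th k x by apply: distc_gt0 => //; exact: nUO.
    (* One index serves both as number of summands and as multiplier. Since [M S_M] increases with
       [M], the largest index of a finite subcover then works at every point. *)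
    pose M := maxn k.+1 (Num.bound (th k x)^-1).
    exists M => //=.
    apply: (@lt_le_trans _ _ (M%:R * th k x)).
      rewrite -ltr_pdivrMr // div1r.
      apply: (@lt_le_trans _ _ (Num.bound (th k x)^-1)%:R).
        by apply: archi_boundP; rewrite invr_ge0 ltW.
      by rewrite ler_nat leq_maxr.
    rewrite ler_wpM2l //; apply: (@le_trans _ _ (S k.+1 x)).
      by rewrite SS lerDr sumr_ge0.
    by apply: Smono; exact: leq_maxl.
  exists (\max_(i <- finmap.enum_fset D) i)%N => x cx.
  have [M /= MD hM] := KD x cx.
  apply: le_trans (ltW hM) _; apply: ler_pM => //; first exact: sumr_ge0.
    by rewrite ler_nat; apply: leq_bigmax_seq.
  by apply: Smono; apply: leq_bigmax_seq.
(* The increments of this decreasing sequence decompose [g] into functions that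
   vanish off the [U k]. *)
pose r k x := Num.max (g x - N%:R * S k x) 0.
have S0 k x : 0 <= S k x by exact: sumr_ge0.
have rC k : Cc Om (r k).
  apply: (Cc_sub gC) => [|x gx].
    apply: continuous_maxr; last exact: continuous_cst.
    apply: continuous_subr; first exact: gC.1.
    exact: continuous_mulr (@continuous_cst R n _) (cS k).
  by rewrite /r gx sub0r max_r // oppr_le0 mulr_ge0.
have rS k x : r k.+1 x <= r k x.
  rewrite /r ge_max le_max [X in _ && X]le_max lexx orbT andbT.
  by rewrite lerD2l lerN2 ler_wpM2l // SS lerDl.
have rle k : ((L (fun x => r k x - r k.+1 x))%:E <= mopen (U k))%E.
  apply: le_mopen; split; first exact: CcB.
    move=> x; rewrite subr_ge0 rS /=.
    have r1 : r k x <= 1.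
      rewrite /r ge_max ler01 andbT lerBlDr.
      by case/andP: (g01 x) => _ h; rewrite (le_trans h) // lerDl mulr_ge0.
    by rewrite lerBlDr (le_trans r1) // lerDl le_max lexx orbT.
  move=> x xU; rewrite /r SS (_ : th k x = 0) ?addr0 ?subrr //.
  by apply: distc_out => // -[].
have rsum k : ((L g)%:E <= \sum_(0 <= j < k) mopen (U j) + (L (r k))%:E)%E.
  elim: k => [|k IH].
    rewrite big_geq // add0e lee_fin; apply: (le_positive_linear Lp) => // x.
    by rewrite /r /S big_ord0 mulr0 subr0 le_max lexx.
  rewrite big_nat_recr //=; apply: (le_trans IH); rewrite -addeA leeD2l //.
  apply: (@le_trans _ _ ((L (fun x => r k x - r k.+1 x))%:E + (L (r k.+1))%:E)%E).
    by rewrite -EFinD lee_fin (positive_linearB Lp) // subrK.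
  by rewrite leeD2r.
apply: (le_trans (rsum N)).
rewrite (_ : r N = (fun=> 0)) ?(positive_linear0 Lp) ?adde0.
  by apply: nneseries_lim_ge => k _ _; exact: mopen_ge0.
apply/funext => x; rewrite /r max_r //.
have [gx|gx] := eqVneq (g x) 0; first by rewrite gx sub0r oppr_le0 mulr_ge0.
rewrite subr_le0; apply: le_trans (KN _ (gc _ gx)).
by case/andP: (g01 x).
Qed.

Lemma mext_sigma_subadditive : sigma_subadditive mext.
Proof.
move=> A; have [[k Ak]|fin] := pselect (exists k, mext (A k) = +oo%E).
  apply: (@le_trans _ _ +oo%E); first exact: leey.
  rewrite -Ak; apply: (@le_trans _ _ (\sum_(0 <= j < k.+1) mext (A j))%E).
    by rewrite big_nat_recr //= leeDr // sume_ge0 // => j _; exact: mext_ge0.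
  by apply: nneseries_lim_ge => j _ _; exact: mext_ge0.
apply/lee_addgt0Pr => e e0.
have exU k : exists U, [/\ open U, A k `&` Om `<=` U &
    (mopen U <= mext (A k) + (e / (2 ^ k.+1)%:R)%:E)%E].
  have [||_ [U [oU AU] <-] h] := @lb_ereal_inf_adherent R
    [set mopen U | U in [set U | open U /\ A k `&` Om `<=` U]] (e / (2 ^ k.+1)%:R).
  - by rewrite divr_gt0 // ltr0n expn_gt0.
  - rewrite ge0_fin_numE; last exact: mext_ge0.
    by rewrite ltey; apply/eqP => h; apply: fin; exists k.
  by exists U; split => //; exact: ltW.
have /choice[U hU] := exU.
apply: (@le_trans _ _ (mopen (\bigcup_k U k))).
  apply: mext_le; first by apply: bigcup_open => k _; case: (hU k).
  by move=> x [[k _ Akx] xO]; exists k => //; case: (hU k) => _ + _; apply.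
apply: le_trans (mopen_bigcup _) _; first by move=> k; case: (hU k).
apply: (@le_trans _ _ (\sum_(0 <= k <oo) (mext (A k) + (e / (2 ^ k.+1)%:R)%:E))%E).
  by apply: lee_nneseries => [k _ _|k _]; [exact: mopen_ge0 | case: (hU k)].
by apply: epsilon_trick; [move=> k; exact: mext_ge0 | exact: ltW].
Qed.

HB.instance Definition _ := isOuterMeasure.Build R V mext
  mext0 mext_ge0 mext_mono mext_sigma_subadditive.

(** The competitor [g] inside [W] and [U] is trimmed to the closed set [c <= f]; the other
    competitor [h] lives on [W] minus that set, which still covers the part of [X] outside [U]. As
    they are never both nonzero, [g + h] stays at most 1 and competes for [W]. *)
Lemma open_caratheodory U : open U -> caratheodory_measurable mext U.
Proof.
move=> oU; apply: le_caratheodory_measurable => X.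
apply: le_ereal_inf_tmp => _ [W [oW XW] <-].
apply: (@le_trans _ _ (mopen (W `&` U) + mext (X `&` ~` U))%E).
  rewrite leeD2r //; apply: mext_le; first exact: openI.
  by move=> x [[xX xU] xO]; split => //; apply: XW.
have [->|Wfin] := eqVneq (mopen W) +oo%E; first exact: leey.
have mXU : mext (X `&` ~` U) \is a fin_num.
  rewrite ge0_fin_numE; last exact: mext_ge0.
  apply: (@le_lt_trans _ _ (mopen W)); last by rewrite ltey.
  by apply: mext_le => // x [[xX _] xO]; apply: XW.
rewrite -leeBrDr //; apply: ub_ereal_sup => _ [f fU <-].
rewrite leeBrDr //; apply/lee_addgt0Pr => e e0.
have [g [c [gU fg c0 gc]]] := below_trim fU e0.
apply: (@le_trans _ _ ((L g + e)%:E + mext (X `&` ~` U))%E); first by rewrite leeD2r.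
rewrite EFinD addeAC leeD2r //.
have fC : Cc Om f by case: fU.
have clK : closed [set x | c <= f x].
  by apply: compact_closed => //; exact: closed_compact_superlevel fC c0.
rewrite addeC -leeBrDr //.
apply: (@le_trans _ _ (mopen (W `&` ~` [set x | c <= f x]))).
  apply: mext_le; first by apply: openI => //; exact: closed_openC.
  move=> x [[xX xU] xO]; split; first exact: XW.
  by move=> /= cx; case: fU => _ _ /(_ x) h; rewrite h ?leNgt ?c0 // in cx => -[].
apply: ub_ereal_sup => _ [h [hC h01 hU] <-].
rewrite leeBrDr // -EFinD; case: (Lp) => LD _ _; rewrite -LD //; last by case: gU.
have [gC g01 gU0] := gU.
apply: le_mopen; split; first exact: CcD.
  move=> x; have /andP[g0 g1] := g01 x; have /andP[h0 h1] := h01 x.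
  rewrite addr_ge0 //=.
  have [->|gx] := eqVneq (g x) 0; first by rewrite addr0.
  by rewrite hU ?add0r // => -[_]; apply; exact: gc.
move=> x xW; rewrite hU ?gU0 ?addr0 //; by move=> -[].
Qed.

Lemma borel_caratheodory (A : set (Rn R n)) :
  measurable A -> caratheodory_measurable mext A.
Proof.
move=> mA; suff : @measurable _ (caratheodory_type mext) A by [].
move: A mA; apply: smallest_sub; first exact: sigma_algebra_measurable.
by move=> U oU; exact: open_caratheodory.
Qed.

Lemma mext_semi_sigma_additive : semi_sigma_additive (mext : set (Rn R n) -> \bar R).
Proof.
move=> F mF tF mUF.
by apply: (@caratheodory_measure_sigma_additive R V mext) => // [i|]; exact: borel_caratheodory.
Qed.

Definition riesz_measure : set (Rn R n) -> \bar R := mext.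

HB.instance Definition _ := isMeasure.Build _ (Rn R n) R riesz_measure
  mext0 mext_ge0 mext_semi_sigma_additive.

Lemma ex_riesz_measure :
  exists m : {measure set (Rn R n) -> \bar R}, forall A, m A = mext A.
Proof. by exists riesz_measure. Qed.

End Riesz.

(** * Uniqueness of a functional with prescribed masses of open sets *)

Section Sandwich.
Context {R : realType} {n : nat}.
Local Notation V := 'rV[R]_n.
Variable Om : set V.
Hypotheses (oOm : open Om) (nOm : ~` Om !=set0).
Implicit Types (f g : V -> R) (U : set V) (X Y : (V -> R) -> R) (M : set V -> \bar R).

(* [M] gives the mass of open sets. Slicing a function into layers shows that two
   functionals sandwiched by the same [M] agree. *)
Definition sandwiched M X : Prop :=
  [/\ positive_linear Om X,
      forall U f, open U -> below Om U f -> ((X f)%:E <= M U)%E &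
      forall U f, open U -> Cc Om f -> (forall x, 0 <= f x) ->
        (forall x, U x -> 1 <= f x) -> (M U <= (X f)%:E)%E].

(** With layers of height [1 / N], the function [N (r_k - r_(k+1))] lies between the indicators of
    [f > (k+1)/N] and [f > k/N]. The bounds for [X] and [Y] are thus shifted by one layer and
    telescope: [N (X f - Y f)] is at most the mass of [f > 0], hence at most [X chi], for every
    [N]. *)
Lemma sandwiched_le M X Y f : sandwiched M X -> sandwiched M Y ->
  below Om setT f -> X f <= Y f.
Proof.
move=> [Xp X1 X2] [Yp Y1 Y2] [fC f01 _].
have [cf [K [cK KO K0]]] := fC.
have [chi [_ [chiC chi01 chi1 _ _]]] := cutoff oOm nOm cK KO.
pose E (N k : nat) := [set x | k%:R / N%:R < f x].
have oE N k : open (E N k) by exact: open_superlevel.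
have E0 N k : (M (E N k) <= (X chi)%:E)%E.
  apply: X2 => // x; first by case/andP: (chi01 x).
  rewrite /E /= => h; rewrite chi1 //; apply: contrapT => /K0 fx.
  by move: h; rewrite fx ltNge divr_ge0.
have M0 U : open U -> (0 <= M U)%E.
  move=> oU; rewrite -[0%E]/(0%:E) -(positive_linear0 Xp).
  exact: X1 oU (below0 Om U).
pose e N k := fine (M (E N k)).
have eE N k : M (E N k) = (e N k)%:E.
  rewrite fineK // ge0_fin_numE; first exact: le_lt_trans (E0 N k) (ltry _).
  exact: M0.
have e0 N k : 0 <= e N k by apply: fine_ge0; exact: M0.
pose r (N k : nat) x := Num.max (f x - k%:R / N%:R) 0.
have rC N k : Cc Om (r N k).
  apply: (Cc_sub fC) => [|x fx].
    apply: continuous_maxr; last exact: continuous_cst.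
    by apply: continuous_subr cf _; exact: continuous_cst.
  by rewrite /r fx sub0r max_r // oppr_le0 divr_ge0.
have sN N k : (0 < N)%N -> (k.+1)%:R / N%:R = k%:R / N%:R + N%:R^-1 :> R.
  by move=> N0; rewrite -natr1 mulrDl mul1r.
have step Z N k : (0 < N)%N -> sandwiched M Z ->
    e N k.+1 <= N%:R * (Z (r N k) - Z (r N k.+1)) <= e N k.
  move=> N0 [Zp Z1 Z2].
  have N0' : 0 < N%:R :> R by rewrite ltr0n.
  rewrite -(positive_linearB Zp) //; case: (Zp) => _ ZZ _; rewrite -ZZ; last exact: CcB.
  rewrite -!lee_fin -!eE.
  have hC : Cc Om (fun x => N%:R * (r N k x - r N k.+1 x)) by apply: CcZ; exact: CcB.
  have hx x : [/\ 0 <= N%:R * (r N k x - r N k.+1 x),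
       N%:R * (r N k x - r N k.+1 x) <= 1,
       (k%:R / N%:R < f x \/ N%:R * (r N k x - r N k.+1 x) = 0) &
       k.+1%:R / N%:R < f x -> N%:R * (r N k x - r N k.+1 x) = 1].
    rewrite /r sN //; set a := k%:R / N%:R; have : N%:R * N%:R^-1 = 1 :> R.
      by rewrite mulfV // gt_eqF.
    have : 0 < N%:R^-1 :> R by rewrite invr_gt0.
    move: (N%:R^-1) => b b0 Nb.
    rewrite /Num.max; case: ltP => h1; case: ltP => h2; split;
      first [lra | nra | by move=> ?; nra | by left; lra | by right; nra].
  apply/andP; split.
    apply: Z2 => // x; first by case: (hx x).
    by rewrite /E /= => h; case: (hx x) => _ _ _ ->.
  apply: Z1 => //; split => // x; first by case: (hx x) => -> ->.
  by rewrite /E /= => h; case: (hx x) => _ _ [].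
have bound N : (0 < N)%N -> N%:R * (X f - Y f) <= e N 0%N.
  move=> N0.
  have hk k : N%:R * (X (r N 0%N) - X (r N k)) - N%:R * (Y (r N 0%N) - Y (r N k))
      <= e N 0%N - e N k.
    elim: k => [|k IH]; first by rewrite !subrr.
    have /andP[_ hX] := step X N k N0 (And3 Xp X1 X2).
    have /andP[hY _] := step Y N k N0 (And3 Yp Y1 Y2).
    by lra.
  have r0 : r N 0%N = f.
    apply/funext => x; rewrite /r mul0r subr0 max_l //.
    by case/andP: (f01 x).
  have rN : r N N = (fun=> 0).
    apply/funext => x; rewrite /r max_r // divff ?pnatr_eq0 -?lt0n // subr_le0.
    by case/andP: (f01 x).
  have := hk N; rewrite r0 rN (positive_linear0 Xp) (positive_linear0 Yp) !subr0.
  by have := e0 N N; lra.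
have e0le N : e N 0%N <= X chi by rewrite -lee_fin -eE.
have X0 : 0 <= X chi by apply: le_trans (e0le 0%N).
rewrite leNgt; apply/negP; rewrite -subr_gt0 => XY.
have := archi_boundP (divr_ge0 X0 (ltW XY)).
set N := Num.bound _ => hN.
have N0 : (0 < N)%N.
  by rewrite -(ltr0n R); apply: le_lt_trans hN; rewrite divr_ge0 // ltW.
have := le_trans (bound N N0) (e0le N).
by rewrite leNgt -ltr_pdivrMr // hN.
Qed.

Lemma sandwiched_eq M X Y f : sandwiched M X -> sandwiched M Y ->
  Cc Om f -> X f = Y f.
Proof.
move=> SX SY fC.
have base g : below Om setT g -> X g = Y g.
  by move=> gb; apply/eqP; rewrite eq_le !(@sandwiched_le M).
have [Xp _ _] := SX; have [Yp _ _] := SY.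
have [c c0 fc] := Cc_bounded fC.
have pos g : Cc Om g -> (forall x, 0 <= g x <= c) -> X g = Y g.
  move=> gC g0c; rewrite (_ : g = (fun x => c * (c^-1 * g x))); last first.
    by apply/funext => x; rewrite mulrA mulfV ?mul1r // gt_eqF.
  have hC : Cc Om (fun x => c^-1 * g x) by exact: CcZ.
  case: (Xp) => _ XZ _; case: (Yp) => _ YZ _; rewrite XZ // YZ // base //.
  split => // [x|x /(_ I)//]; have /andP[g0 gc] := g0c x.
  by rewrite mulr_ge0 ?invr_ge0 ?(ltW c0) //= mulrC ler_pdivrMr // mul1r.
have f1C : Cc Om (fun x => Num.max (f x) 0) by exact: Cc_max0.
have f2C : Cc Om (fun x => Num.max (f x) 0 - f x) by exact: CcB.
rewrite (_ : f = (fun x => Num.max (f x) 0 - (Num.max (f x) 0 - f x))).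
  rewrite (positive_linearB Xp) // (positive_linearB Yp) // !pos // => x;
    by have := fc x; rewrite ler_norml /Num.max => /andP[h1 h2]; case: ltP => h; lra.
by apply/funext => x; rewrite subKr.
Qed.

Variable m : {measure set (Rn R n) -> \bar R}.
Hypothesis mfin : forall K : set V, compact K -> K `<=` Om -> (m (K : set (Rn R n)) < +oo)%E.

Lemma Cc_integral_EFin f : Cc Om f ->
  (\int[m]_x (f x)%:E)%E = (Rintegral m setT f)%:E.
Proof.
move=> fC; rewrite /Rintegral fineK // integrable_fin_num //.
exact: Cc_integrable fC.
Qed.

Lemma sandwiched_integral : sandwiched m (Rintegral m setT).
Proof.
have mi f : Cc Om f -> m.-integrable setT (EFin \o f) by exact: Cc_integrable.
split.
- split.
  + by move=> f g fC gC; rewrite RintegralD //; exact: mi.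
  + by move=> c f fC; rewrite RintegralZl //; exact: mi.
  + by move=> f _ f0; apply: Rintegral_ge0.
- move=> U f oU [fC f01 fU]; have mU := measurable_open oU.
  rewrite -Cc_integral_EFin // -[m U]mul1e -integral_cst //.
  rewrite [leRHS]integral_mkcond; apply: ge0_le_integral => //.
  + by move=> x _; rewrite lee_fin; case/andP: (f01 x).
  + by apply/measurable_EFinP; apply: measurable_continuous; exact: fC.1.
  + by apply/(measurable_restrictT _ _).1.
  + move=> x _; rewrite /patch; case: ifP => xU /=; rewrite lee_fin //.
    by case/andP: (f01 x).
    by rewrite fU // => h; move: xU; rewrite mem_set.
- move=> U f oU fC f0 f1; have mU := measurable_open oU.
  rewrite -Cc_integral_EFin // -[m U]mul1e -integral_cst //.
  rewrite [leLHS]integral_mkcond; apply: ge0_le_integral => //.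
  + move=> x _; rewrite /patch; case: ifP => _ //=.
  + apply/(measurable_restrictT _ _).1 => //.
  + by apply/measurable_EFinP; apply: measurable_continuous; exact: fC.1.
  + move=> x _; rewrite /patch; case: ifP => xU; rewrite lee_fin //.
    by apply: f1; rewrite inE in xU.
Qed.

End Sandwich.

(** * Local finiteness and the representation formula *)

Section RieszRepresentation.
Context {R : realType} {n : nat}.
Local Notation V := 'rV[R]_n.
Variable Om : set V.
Hypotheses (oOm : open Om) (nOm : ~` Om !=set0).
Variable L : (V -> R) -> R.
Hypothesis Lp : positive_linear Om L.
Variable m : {measure set (Rn R n) -> \bar R}.
Hypothesis mE : forall A, m A = mext Om L A.

Lemma riesz_loc_finite : loc_finite_on Om m.
Proof.
split.
  apply/eqP; rewrite mE eq_le (mext_ge0 Lp) andbT -(mext0 Lp).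
  rewrite (@mext_open _ _ _ _ set0 open0); apply: mext_le; first exact: open0.
  by move=> x [].
move=> K cK KO; have [chi [_ [chiC chi01 chi1 _ _]]] := cutoff oOm nOm cK KO.
(* On this open neighbourhood of [K] the function [2 chi] exceeds 1, so it dominates every
   competitor and [2 L(chi)] bounds the mass of [K]. *)
pose U := [set x | 2^-1 < chi x].
have oU : open U by apply: open_superlevel; exact: chiC.1.
apply: (@le_lt_trans _ _ (2 * L chi)%:E); last exact: ltry.
rewrite mE; apply: (@le_trans _ _ (mopen Om L U)).
  by apply: mext_le => // x [/chi1 cx _]; rewrite /U /= cx; lra.
apply: ub_ereal_sup => _ [f [fC f01 fU] <-]; rewrite lee_fin.
case: (Lp) => _ LZ _; rewrite -LZ //.
apply: (le_positive_linear Lp) => //; first exact: CcZ.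
move=> x; have /andP[f0 f1] := f01 x; have /andP[c0 c1] := chi01 x.
have [xU|/fU ->] := pselect (U x); last by rewrite mulr_ge0.
by apply: (le_trans f1); move: xU; rewrite /U /=; lra.
Qed.

Lemma sandwiched_functional : sandwiched Om m L.
Proof.
split => // [U f oU|U f oU fC f0 f1]; rewrite mE mext_open //; first exact: le_mopen.
apply: ub_ereal_sup => _ [g [gC g01 gU] <-].
rewrite lee_fin; apply: (le_positive_linear Lp) => // x.
have [xU|/gU -> //] := pselect (U x).
by case/andP: (g01 x) => _ /le_trans; apply; exact: f1.
Qed.

Theorem riesz_representation f : Cc Om f -> (\int[m]_x (f x)%:E)%E = (L f)%:E.
Proof.
have [_ mfin] := riesz_loc_finite.
move=> fC; rewrite (Cc_integral_EFin mfin) //; congr EFin.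
exact: sandwiched_eq (sandwiched_integral mfin) sandwiched_functional fC.
Qed.

End RieszRepresentation.

(** * Lebesgue measure on R^n *)

Section LebesgueMeasure.
Context {R : realType} {n : nat}.
Local Notation V := 'rV[R]_n.
Local Notation T := (Rn R n).
Implicit Types (a b v x : V) (f : V -> R).

Definition box a b : set V := [set x | forall i, a 0 i <= x 0 i < b 0 i].

Lemma coord_continuousV (i : 'I_n) : continuous (fun x : V => x 0 i).
Proof. exact: coord_continuous. Qed.

Lemma measurable_box a b : measurable (box a b : set T).
Proof.
rewrite (_ : box a b = \bigcap_(i in [set: 'I_n])
    ([set x | a 0 i <= x 0 i] `&` [set x | x 0 i < b 0 i])).
  apply: fin_bigcap_measurable => [|i _]; first exact: finite_finset.
  apply: measurableI.
    apply: measurable_closed.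
    apply: (@closed_comp _ _ (fun x : V => x 0 i) [set r | a 0 i <= r]) => [x _|].
      exact: coord_continuousV.
    exact: closed_ge.
  apply: measurable_open.
  apply: (@open_comp _ _ (fun x : V => x 0 i) [set r | r < b 0 i]) => [x _|].
    exact: coord_continuousV.
  exact: open_lt.
apply/seteqP; split => x /= h i.
  by have /andP[? ?] := h i.
by have [? ?] := h i I; apply/andP.
Qed.

Lemma box_setI a b a' b' : box a b `&` box a' b' =
  box (\row_i Num.max (a 0 i) (a' 0 i)) (\row_i Num.min (b 0 i) (b' 0 i)).
Proof.
apply/seteqP; split => x /=.
  move=> [h h'] i; have /andP[h1 h2] := h i; have /andP[h3 h4] := h' i.
  by rewrite !mxE ge_max lt_min h1 h2 h3 h4.
by move=> h; split => i; have := h i;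
  rewrite !mxE ge_max lt_min => /andP[/andP[h1 h2] /andP[h3 h4]]; apply/andP.
Qed.

(** An open set is the union of the boxes with rational corners that it contains. Balls of [V] are
    cubes, so corners within [e] of [x] in each coordinate give a box inside the ball. *)
Lemma open_sigma_box : @open V `<=` <<s [set box p.1 p.2 | p in [set: V * V]] >>.
Proof.
move=> U oU; pose G := [set box p.1 p.2 | p in [set: V * V]].
pose rv (q : 'rV[rat]_n) : V := map_mx ratr q.
pose F (q : 'rV[rat]_n * 'rV[rat]_n) : set (g_sigma_algebraType G) :=
  if `[< box (rv q.1) (rv q.2) `<=` U >] then box (rv q.1) (rv q.2) else set0.
rewrite (_ : U = \bigcup_q F q).
  apply: (@countable_bigcupT_measurable _ (g_sigma_algebraType G)) => // q.
  rewrite /F; case: asboolP => _; last exact: measurable0.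
  by apply: sub_sigma_algebra; exists (rv q.1, rv q.2).
apply/seteqP; split => [x xU|x [q _]]; last by rewrite /F; case: asboolP => // h /h.
have /nbhs_ballP[e /= e0 eU] : nbhs x U by exact: open_nbhs_nbhs.
have ex (i : 'I_n) : exists q : rat * rat,
    (x 0 i - e < ratr q.1 <= x 0 i) /\ (x 0 i < ratr q.2 < x 0 i + e).
  have [p] := @rat_in_itvoo R (x 0 i - e) (x 0 i) ltac:(lra).
  rewrite in_itv /= => /andP[p1 p2].
  have [q] := @rat_in_itvoo R (x 0 i) (x 0 i + e) ltac:(lra).
  rewrite in_itv /= => /andP[q1 q2].
  by exists (p, q) => /=; rewrite p1 q1 q2 ltW.
have /choice[q hq] := ex.
exists (\row_i (q i).1, \row_i (q i).2) => //; rewrite /F.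
have xb : box (rv (\row_i (q i).1)) (rv (\row_i (q i).2)) x.
  by move=> i; rewrite !mxE; have [/andP[_ ->] /andP[-> _]] := hq i.
rewrite ifT //; apply/asboolP => y yb; apply: eU; split => // i j; rewrite ord1.
have := yb j; rewrite !mxE => /andP[y1 y2]; have [/andP[h1 h2] /andP[h3 h4]] := hq j.
rewrite /ball /= ltr_norml; apply/andP; split; lra.
Qed.

Lemma measure_box_unique (m1 m2 : {measure set T -> \bar R}) :
  (forall a b, m1 (box a b : set T) = m2 (box a b : set T)) ->
  (forall a b, m1 (box a b : set T) < +oo)%E ->
  forall A, measurable A -> m1 A = m2 A.
Proof.
move=> m12 fin; pose G : set (set T) := [set box p.1 p.2 | p in [set: V * V]].
apply: (measure_unique G (fun k => box (const_mx (- k%:R)) (const_mx k%:R))).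
- apply/seteqP; split; apply: smallest_sub.
  + exact: smallest_sigma_algebra.
  + exact: open_sigma_box.
  + exact: sigma_algebra_measurable.
  + by move=> _ [p _ <-]; exact: measurable_box.
- move=> _ _ [p _ <-] [q _ <-]; rewrite box_setI.
  by exists (\row_i Num.max (p.1 0 i) (q.1 0 i), \row_i Num.min (p.2 0 i) (q.2 0 i)).
- by move=> k; exists (const_mx (- k%:R), const_mx k%:R).
- apply/seteqP; split => // x _; exists (Num.bound `|x|) => // i; rewrite !mxE.
  have : `|x 0 i| < (Num.bound `|x|)%:R.
    by apply: le_lt_trans (coord_le_mxnorm x i) _; exact: archi_boundP.
  by rewrite ltr_norml => /andP[/ltW -> ->].
- by move=> _ [p _ <-].
- by move=> k; exact: fin.
Qed.

Variable lam : {measure set T -> \bar R}.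
Hypothesis lamP : is_lebesgue lam.

Lemma box_empty a b : ~ (forall i, a 0 i <= b 0 i) -> box a b = set0.
Proof.
move=> h; apply/seteqP; split => // x xb; apply: h => i.
by have /andP[h1 /ltW] := xb i; exact: le_trans.
Qed.

Lemma lebesgue_box_fin a b : (lam (box a b : set T) < +oo)%E.
Proof.
have [ab|ab] := pselect (forall i, a 0 i <= b 0 i); first by rewrite lamP // ltry.
by rewrite box_empty // measure0 ltry.
Qed.

Lemma lebesgue_compact_fin (K : set V) : compact K -> (lam (K : set T) < +oo)%E.
Proof.
move=> cK; have [r r0 Kr] := compact_enorm cK.
apply: (@le_lt_trans _ _ (lam (box (const_mx (- (r + 1))) (const_mx (r + 1)) : set T))).
  apply: le_measure; rewrite ?inE; first exact: measurable_compact.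
    exact: measurable_box.
  move=> x /Kr xr i; rewrite !mxE; have := le_trans (coord_le_enorm x i) xr.
  by rewrite ler_norml => /andP[h1 h2]; apply/andP; split; lra.
exact: lebesgue_box_fin.
Qed.

Lemma shift_continuous v : continuous (fun x : V => x + v).
Proof. by move=> x; apply: continuousD; [move=> y; exact: cvg_id | exact: cst_continuous]. Qed.

Lemma measurable_shift v : measurable_fun setT ((fun x => x + v) : T -> T).
Proof.
apply: (@measurability _ _ T T setT _ (@open V)) => // _ [U oU <-]; rewrite setTI.
apply: measurable_open; apply: open_comp => // x _; exact: shift_continuous.
Qed.

(** Translates of boxes are boxes of equal volume, and the values on boxes determine the measure.
    This invariance is the source of all discrete integrations by parts below. *)
Lemma lebesgue_shift v (A : set T) : measurable A ->
  pushforward lam ((fun x => x + v) : T -> T) A = lam A.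
Proof.
move=> mA; have ms := measurable_shift v.
have preb a b : ((fun x => x + v) : T -> T) @^-1` (box a b) = box (a - v) (b - v).
  by apply/seteqP; split => x /= h i; have := h i; rewrite !mxE lerBlDr ltrBrDr.
apply: measure_box_unique mA => a b; rewrite /= /pushforward preb; last exact: lebesgue_box_fin.
have [ab|ab] := pselect (forall i, a 0 i <= b 0 i).
  rewrite !lamP // => [|i]; last by rewrite !mxE lerD2r.
  by congr EFin; apply: eq_bigr => i _; rewrite !mxE; ring.
rewrite !box_empty // => h; apply: ab => i; have := h i; by rewrite !mxE lerD2r.
Qed.

Lemma Cc_shift f v : Cc setT f -> Cc setT (fun x => f (x + v)).
Proof.
move=> [cf [K [cK _ K0]]]; split.
  by move=> x; apply: continuous_comp; [exact: shift_continuous | exact: cf].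
exists ((fun x => x - v) @` K); split => //.
  by apply: continuous_compact => //; apply: continuous_subspaceT; exact: shift_continuous.
by move=> x xK; apply: K0 => h; apply: xK; exists (x + v) => //; rewrite addrK.
Qed.

Lemma lebesgue_integrable f : Cc setT f -> lam.-integrable setT (EFin \o f).
Proof. by apply: Cc_integrable => K cK _; exact: lebesgue_compact_fin. Qed.

Lemma Rintegral_shift f v : Cc setT f ->
  Rintegral lam setT (fun x => f (x + v)) = Rintegral lam setT f.
Proof.
move=> fC; rewrite /Rintegral; congr fine.
have ms := measurable_shift v.
rewrite -[in LHS](preimage_setT ((fun x => x + v) : T -> T)).
rewrite -(@integral_pushforward _ _ _ _ _ _ ms lam setT (EFin \o f)) //.
- by apply: eq_measure_integral => A mA _; exact: lebesgue_shift.
- by apply/measurable_EFinP; apply: measurable_continuous; exact: fC.1.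
- by rewrite preimage_setT; exact: lebesgue_integrable (Cc_shift v fC).
Qed.

End LebesgueMeasure.

(** * Second-order expansion and the curvature bound *)

Section Calculus.
Context {R : realType}.

Lemma mvt_closed (f df : R -> R) (a b : R) : a <= b ->
  (forall t, a <= t <= b -> is_derive t 1 f (df t)) ->
  exists2 c, a <= c <= b & f b - f a = df c * (b - a).
Proof.
move=> ab fd; have [||c] := @MVT_segment R f df a b ab.
- by move=> x; rewrite in_itv /= => /andP[h1 h2]; apply: fd; rewrite !ltW.
- apply: derivable_within_continuous => x; rewrite in_itv /= => /fd h.
  exact: ex_derive.
by rewrite in_itv /= => h1 h2; exists c.
Qed.

(** The mean value theorem is applied twice: to the even function [F] on [[0, h]], then to [k] on
    [[- s, s]]. The factor 2 comes from bounding the intermediate point [s] by [h]. *)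
Lemma second_difference_le (g g1 g2 : R -> R) (c M h : R) : 0 <= h ->
  (forall t : R, is_derive t 1 g (g1 t)) -> (forall t : R, is_derive t 1 g1 (g2 t)) ->
  (forall t, `|t| <= h -> `|g2 t - c| <= M) ->
  `|g h + g (- h) - 2 * g 0 - c * h ^+ 2| <= 2 * M * h ^+ 2.
Proof.
move=> h0 d1 d2 gM.
have dneg (t : R) : is_derive t 1 (fun s => g (- s)) (- g1 (- t)).
  have := @is_derive1_comp R g (fun s => - s) t (g1 (- t)) (- 1) (d1 _) _.
  by rewrite mulrN1; apply; exact: is_deriveNid.
pose F t := g t + g (- t) - c * t ^+ 2.
pose F1 t := g1 t - g1 (- t) - c * (2 * t).
have dF (t : R) : is_derive t 1 F (F1 t).
  have h2 : is_derive t 1 (fun s : R => c * s ^+ 2) (c * (2 * t)).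
    by apply: is_derive_eq; rewrite /GRing.scale /=; ring.
  exact: is_deriveB (is_deriveD (d1 t) (dneg t)) h2.
have [s /andP[s0 sh] hs] := @mvt_closed F F1 0 h h0 (fun t _ => dF t).
pose k t := g1 t - c * t.
pose k1 t := g2 t - c.
have dk (t : R) : is_derive t 1 k (k1 t).
  have h2 : is_derive t 1 (fun s : R => c * s) c.
    by apply: is_derive_eq; rewrite /GRing.scale /=; ring.
  exact: is_deriveB (d2 t) h2.
have ss : - s <= s by lra.
have [u /andP[u1 u2] hu] := @mvt_closed k k1 (- s) s ss (fun t _ => dk t).
have := gM u; rewrite ler_norml (_ : (- h <= u <= h)) //; last by apply/andP; split; lra.
move=> /(_ isT) hM.
have -> : g h + g (- h) - 2 * g 0 - c * h ^+ 2 = F h - F 0.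
  by rewrite /F oppr0; ring.
rewrite hs subr0 (_ : F1 s = k s - k (- s)); last by rewrite /F1 /k; ring.
rewrite hu opprK !normrM (ger0_norm h0) (@ger0_norm _ (s + s)); last lra.
have := normr_ge0 (k1 u); rewrite -/(k1 u) in hM; move: hM; move: `|k1 u| => z zM z0.
have : z * (s + s) <= M * (2 * h) by apply: ler_pM => //; lra.
by rewrite expr2; nra.
Qed.

Context {n : nat}.
Local Notation V := 'rV[R]_n.

Lemma is_derive_line (f : V -> R) x v (t : R) : derivable f (x + t *: v) v ->
  is_derive t 1 (fun s : R => f (x + s *: v)) ('D_v f (x + t *: v)).
Proof.
move=> df.
have E : (fun h : R => h^-1 *: (((fun s : R => f (x + s *: v)) \o shift t) (h *: 1) -
    f (x + t *: v))) =
  (fun h : R => h^-1 *: ((f \o shift (x + t *: v)) (h *: v) - f (x + t *: v))).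
  apply/funext => h /=; congr (_ *: (f _ - _)).
  by rewrite [h%:A]mulr1 scalerDl addrCA.
apply: DeriveDef; first by rewrite /derivable E.
by rewrite /derive E.
Qed.

Lemma mvt_direction (f : V -> R) x v (c : R) :
  (forall t, 0 <= t <= 1 -> derivable f (x + (t * c) *: v) v) ->
  exists2 t, 0 <= t <= 1 & f (x + c *: v) - f x = c * 'D_v f (x + (t * c) *: v).
Proof.
move=> df.
have [t t01 h] : exists2 t, 0 <= t <= 1 &
    f (x + (1 * c) *: v) - f (x + (0 * c) *: v) = (c * 'D_v f (x + (t * c) *: v)) * (1 - 0).
  apply: (@mvt_closed (fun t => f (x + (t * c) *: v))
    (fun t => c * 'D_v f (x + (t * c) *: v))) => // t t01.
  have h1 := is_derive_line (df t t01).
  have h2 : is_derive t 1 (fun s : R => s * c) c.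
    by apply: is_derive_eq; rewrite /GRing.scale /= mulr1 ?mulr0 ?addr0 ?add0r.
  have := @is_derive1_comp R (fun s => f (x + s *: v)) (fun s => s * c) t _ _ h1 h2.
  by rewrite mulrC.
exists t => //; by rewrite mul1r mul0r scale0r addr0 subr0 mulr1 in h.
Qed.

Lemma dot_evec (u : V) i : dot u (evec R i) = u 0 i.
Proof.
rewrite /dot (bigD1 i) //= mxE !eqxx mulr1 big1 ?addr0 // => j ji.
by rewrite mxE eqxx (negbTE ji) mulr0.
Qed.

Lemma enorm_evec i : enorm (evec R i : V) = 1.
Proof. by apply: enorm_eq => //; rewrite dot_evec mxE !eqxx expr1n. Qed.

Definition grad (f : V -> R) x : V := \row_i partial i f x.

(** Partial derivatives continuous at [z] give a total differential there: the coordinates of [u]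
    are switched on one at a time through the truncations [tr m], with a mean value theorem for
    each. Intermediate points have norm at most [|u|], so each partial is within [e / (n + 1)] of
    its value at [z]. *)
Lemma first_order (f : V -> R) z r e : 0 < r -> 0 < e ->
  (forall i x, eball z r x -> derivable f x (evec R i)) ->
  (forall i, {for z, continuous (partial i f)}) ->
  exists2 del, 0 < del & forall u, enorm u < del ->
    `|f (z + u) - f z - dot (grad f z) u| <= e * enorm u.
Proof.
move=> r0 e0 df cf.
pose e' := e / (n%:R + 1).
have n1 : 0 < n%:R + 1 :> R by rewrite ltr_wpDl.
have e'0 : 0 < e' by rewrite divr_gt0.
have ex (i : 'I_n) : exists2 del, 0 < del & forall x, enorm (x - z) < del ->
    `|partial i f x - partial i f z| < e'.
  apply: (@nbhs_eball _ _ z (fun x => `|partial i f x - partial i f z| < e')).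
  have /cvgrPdist_lt/(_ _ e'0) := cf i.
  by apply: filterS => x; rewrite distrC.
have [del [del0 delr hdel]] : exists del, [/\ 0 < del, del <= r & forall (i : 'I_n) x,
    enorm (x - z) < del -> `|partial i f x - partial i f z| < e'].
  have /choice[D hD] : forall i : 'I_n, exists del, 0 < del /\
      forall x, enorm (x - z) < del -> `|partial i f x - partial i f z| < e'.
    by move=> i; have [del d0 h] := ex i; exists del.
  exists (\big[Num.min/r]_(i < n) D i); split.
  - by apply: (@big_ind R (fun s => 0 < s)) => // [x y x0 y0|i _]; [rewrite lt_min x0 y0 | case: (hD i)].
  - exact: bigmin_le_id.
  - move=> i x hx; case: (hD i) => _; apply; apply: lt_le_trans hx _.
    exact: bigmin_le.
exists del => // u ud.
pose tr (m : nat) : V := \row_i (if (i < m)%N then u 0 i else 0).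
have trn : tr n = u by apply/rowP => i; rewrite mxE ltn_ord.
have tr0 : tr 0%N = 0 by apply/rowP => i; rewrite !mxE.
have trS (m : 'I_n) : tr m.+1 = tr m + u 0 m *: evec R m.
  apply/rowP => i; rewrite !mxE eqxx /= ltnS leq_eqVlt.
  have [->|im] := eqVneq i m; first by rewrite eqxx ltnn mulr1 add0r.
  by rewrite (_ : (i == m :> nat) = false) ?mulr0 ?addr0 //=; apply/negbTE.
have small (m : 'I_n) t : 0 <= t <= 1 -> enorm (tr m + (t * u 0 m) *: evec R m) <= enorm u.
  move=> /andP[t0 t1]; apply: enorm_le; first exact: enorm_ge0.
  rewrite enorm_sqr; apply: ler_sum => i _; rewrite !mxE eqxx /= -!expr2.
  have [->|im] := eqVneq i m.
    rewrite ltnn add0r mulr1 exprMn -[leRHS]mul1r ler_wpM2r ?sqr_ge0 //.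
    by rewrite expr_le1.
  by rewrite mulr0 addr0; case: ifP => _ //; rewrite expr0n /= sqr_ge0.
have step (m : 'I_n) :
    `|f (z + tr m.+1) - f (z + tr m) - u 0 m * partial m f z| <= e' * enorm u.
  have [t t01|t t01] := @mvt_direction f (z + tr m) (evec R m) (u 0 m).
    apply: df; rewrite /eball /= -(addrA z) [X in enorm X]addrC addKr.
    by apply: le_lt_trans (small m t t01) _; exact: lt_le_trans delr.
  rewrite trS addrA => ->; rewrite -mulrBr normrM mulrC.
  apply: ler_pM => //; last exact: coord_le_enorm.
  apply: ltW; apply: hdel; rewrite -(addrA z) [X in enorm X]addrC addKr.
  exact: le_lt_trans (small m t t01) _.
have tele (m : nat) : (m <= n)%N ->
    `|f (z + tr m) - f z - \sum_(i < n | (i < m)%N) u 0 i * partial i f z|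
      <= m%:R * (e' * enorm u).
  elim: m => [_|m IH mn].
    rewrite tr0 addr0 subrr big_pred0 => [|i]; last by rewrite ltn0.
    by rewrite subrr normr0 mul0r.
  pose mo := Ordinal mn.
  have := IH (ltnW mn); have := step mo; rewrite /= => h1 h2.
  rewrite (bigD1 mo) ?ltnS //= (eq_bigl (fun i : 'I_n => (i < m)%N)); last first.
    move=> i; rewrite ltnS ltn_neqAle andbC; congr (_ && _).
  rewrite -natr1 mulrDl mul1r.
  apply: le_trans (lerD h2 h1).
  apply: le_trans _ (ler_normD _ _); rewrite le_eqVlt; apply/orP; left; apply/eqP.
  congr `|_|; ring.
have := tele n (leqnn _); rewrite trn.
rewrite (_ : \sum_(i < n | (i < n)%N) _ = dot (grad f z) u); last first.
  by rewrite /dot; apply: eq_big => i; rewrite ?ltn_ord // mxE mulrC.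
move=> h; apply: le_trans h _; rewrite mulrA ler_wpM2r ?enorm_ge0 //.
rewrite /e' mulrCA -[leRHS]mulr1 ler_wpM2l ?(ltW e0) //.
by rewrite ler_pdivrMr // mul1r lerDl.
Qed.

End Calculus.

(** * Taylor expansion of order two for a [C^2] function *)

Section SecondOrder.
Context {R : realType} {n : nat}.
Local Notation V := 'rV[R]_n.
Implicit Types (f psi : V -> R) (x y z u v k : V).

Lemma C1_chain_line f y k (t r : R) : 0 < r ->
  (forall i x, eball (y + t *: k) r x -> derivable f x (evec R i)) ->
  (forall i, {for y + t *: k, continuous (partial i f)}) ->
  is_derive t 1 (fun s : R => f (y + s *: k)) (dot (grad f (y + t *: k)) k).
Proof.
move=> r0 df cf; set z := y + t *: k; set l := dot _ _.
have C : (fun h : R => h^-1 *: (((fun s : R => f (y + s *: k)) \o shift t) (h *: 1) -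
    f (y + t *: k))) @ 0^' --> l.
  apply/cvgrPdist_le => e e0.
  pose e' := e / (enorm k + 1).
  have k1 : 0 < enorm k + 1 by rewrite ltr_wpDl ?enorm_ge0.
  have e'0 : 0 < e' by rewrite divr_gt0.
  have [del d0 hd] := first_order r0 e'0 df cf.
  near=> h.
  have h0 : h != 0 by near: h; exact: nbhs_dnbhs_neq.
  have hs : enorm (h *: k) < del.
    rewrite enormZ; apply: (@le_lt_trans _ _ (`|h| * (enorm k + 1))).
      by rewrite ler_wpM2l // lerDl.
    rewrite -ltr_pdivlMr //; near: h; apply: dnbhs0_lt.
    by rewrite divr_gt0.
  have := hd _ hs; rewrite dotZr enormZ -/l => hl.
  rewrite /= (_ : y + (h%:A + t) *: k = z + h *: k); last first.
    by rewrite [h%:A]mulr1 scalerDl addrCA [RHS]addrC.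
  rewrite -/z distrC.
  have -> : h^-1 *: (f (z + h *: k) - f z) - l = h^-1 * (f (z + h *: k) - f z - h * l).
    by rewrite /GRing.scale /= [RHS]mulrBr mulKf.
  rewrite normrM normfV ler_pdivrMl ?normr_gt0 //.
  apply: le_trans hl _; rewrite mulrCA ler_wpM2l //.
  by rewrite /e' -mulrA -[leRHS]mulr1 ler_wpM2l ?(ltW e0) // ler_pdivrMl // mulr1 lerDl.
apply: DeriveDef; first by apply/cvg_ex; exists l.
exact: cvg_lim C.
Unshelve. all: by end_near. Qed.

Lemma C2_on_open U f : open U -> C2_on U f -> forall x, U x ->
  [/\ {for x, continuous f},
      forall i, {for x, continuous (partial i f)} &
      forall i j, {for x, continuous (partial j (partial i f))}].
Proof.
move=> oU [c0 [c1 c2]] x xU; have xU' : x \in U by rewrite inE.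
split.
- by move: c0; rewrite continuous_open_subspace //; apply.
- by move=> i; have [_] := c1 i; rewrite continuous_open_subspace //; apply.
- by move=> i j; have [_] := c2 i j; rewrite continuous_open_subspace //; apply.
Qed.

(** The Hessian acting on a vector, with entries [sum_j (partial j (partial i psi) y) k_j]. It
    enters the final estimates through quadratic forms, so the order of differentiation never has to
    be exchanged. *)
Definition hess psi y k : V := \row_i dot (grad (partial i psi) y) k.

Lemma hessD psi y u v : hess psi y (u + v) = hess psi y u + hess psi y v.
Proof. by apply/rowP => i; rewrite !mxE dotDr. Qed.

Lemma hessZ psi y c u : hess psi y (c *: u) = c *: hess psi y u.
Proof. by apply/rowP => i; rewrite !mxE dotZr. Qed.

(** One mean value theorem along the segment turns the second-order remainder into the first-order
    remainders of the partial derivatives, which [first_order] controls. *)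
Lemma taylor2 psi y r e : 0 < r -> 0 < e -> C2_on (eball y r) psi ->
  exists2 del, 0 < del & forall k, enorm k < del ->
    `|psi (y + k) - psi y - dot (grad psi y) k - 2^-1 * dot k (hess psi y k)|
      <= e * enorm k ^+ 2.
Proof.
move=> r0 e0 C2.
have yB : eball y r y by rewrite /eball /= subrr enorm0.
have cont := C2_on_open (@open_eball _ _ y r) C2.
pose e' := e / (n%:R + 1).
have n1 : 0 < n%:R + 1 :> R by rewrite ltr_wpDl.
have e'0 : 0 < e' by rewrite divr_gt0.
have [del [del0 delr hdel]] : exists del, [/\ 0 < del, del <= r & forall (i : 'I_n) u,
    enorm u < del -> `|partial i psi (y + u) - partial i psi y -
      dot (grad (partial i psi) y) u| <= e' * enorm u].
  have /choice[D hD] : forall i : 'I_n, exists del, 0 < del /\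
      forall u, enorm u < del -> `|partial i psi (y + u) - partial i psi y -
      dot (grad (partial i psi) y) u| <= e' * enorm u.
    move=> i; have [||del d0 h] := @first_order _ _ (partial i psi) y r e' r0 e'0.
    - by move=> j x xB; case: C2 => _ [_ /(_ i j) [+ _]]; apply.
    - by move=> j; case: (cont y yB).
    by exists del.
  exists (\big[Num.min/r]_(i < n) D i); split.
  - by apply: (@big_ind R (fun s => 0 < s)) => // [x z x0 z0|i _]; [rewrite lt_min x0 z0 | case: (hD i)].
  - exact: bigmin_le_id.
  - move=> i x hx; case: (hD i) => _; apply; apply: lt_le_trans hx _.
    exact: bigmin_le.
exists del => // k kd.
pose F (t : R) := psi (y + t *: k) - t * dot (grad psi y) k - 2^-1 * t ^+ 2 * dot k (hess psi y k).
pose F1 (t : R) := dot (grad psi (y + t *: k)) k - dot (grad psi y) k - t * dot k (hess psi y k).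
have small (t : R) : 0 <= t <= 1 -> enorm (t *: k) < del.
  move=> /andP[t0 t1]; rewrite enormZ ger0_norm //; apply: le_lt_trans kd.
  by rewrite -[leRHS]mul1r ler_wpM2r ?enorm_ge0.
have dF (t : R) : 0 <= t <= 1 -> is_derive t 1 F (F1 t).
  move=> t01; have ts := lt_le_trans (small t t01) delr.
  have zB : eball y r (y + t *: k) by rewrite /eball /= addrC addKr.
  have r'0 : 0 < r - enorm (t *: k) by rewrite subr_gt0.
  have h1 : is_derive t 1 (fun s : R => psi (y + s *: k)) (dot (grad psi (y + t *: k)) k).
    apply: (C1_chain_line r'0) => [i x xB|i]; last by case: (cont _ zB).
    case: C2 => _ [/(_ i) [+ _] _]; apply; rewrite /eball /=.
    apply: le_lt_trans (enorm_dist _ (y + t *: k) _) _.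
    by rewrite [X in _ + enorm X]addrC addKr -ltrBrDr.
  have h2 : is_derive t 1 (fun s : R => s * dot (grad psi y) k) (dot (grad psi y) k).
    by apply: is_derive_eq; rewrite /GRing.scale /=; ring.
  have h3 : is_derive t 1 (fun s : R => 2^-1 * s ^+ 2 * dot k (hess psi y k))
     (t * dot k (hess psi y k)).
    by apply: is_derive_eq; rewrite /GRing.scale /=; field.
  exact: is_deriveB (is_deriveB h1 h2) h3.
have [t t01 h] := @mvt_closed R F F1 0 1 ler01 dF.
have -> : psi (y + k) - psi y - dot (grad psi y) k - 2^-1 * dot k (hess psi y k) = F 1 - F 0.
  by rewrite /F scale1r scale0r addr0; ring.
rewrite h subr0 mulr1.
have -> : F1 t = \sum_(i < n) (partial i psi (y + t *: k) - partial i psi y -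
    dot (grad (partial i psi) y) (t *: k)) * k 0 i.
  rewrite /F1 /dot mulr_sumr -!sumrB; apply: eq_bigr => i _.
  by rewrite -[X in _ = (_ - X) * _]/(dot _ _) dotZr !mxE; ring.
apply: le_trans (ler_norm_sum _ _ _) _.
apply: (@le_trans _ _ (\sum_(i < n) e' * enorm k ^+ 2)).
  apply: ler_sum => i _; rewrite normrM expr2 mulrA.
  apply: ler_pM => //; last exact: coord_le_enorm.
  apply: le_trans (hdel i _ (small t t01)) _; rewrite ler_wpM2l ?(ltW e'0) //.
  case/andP: t01 => t0 t1; rewrite enormZ ger0_norm // -[leRHS]mul1r.
  by rewrite ler_wpM2r ?enorm_ge0.
rewrite sumr_const card_ord -mulr_natl mulrA ler_wpM2r ?sqr_ge0 //.
rewrite /e' mulrCA -[leRHS]mulr1 ler_wpM2l ?(ltW e0) //.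
by rewrite ler_pdivrMr // mul1r lerDl.
Qed.

End SecondOrder.

(** * Geometry of the boundary at a nearest point *)

Section DiscreteLaplacian.
Context {R : realType} {n : nat}.
Local Notation V := 'rV[R]_n.
Implicit Types (f psi : V -> R) (x y z u v k a e : V).

Definition dlap (t : R) f x : R := t ^- 2 *
  \sum_(i < n) (f (x + t *: evec R i) + f (x - t *: evec R i) - 2 * f x).

(** A negative value would put [y] in [Om]; a positive one would, by continuity, keep [Om] away from
    a neighbourhood of [y]. *)
Lemma local_defining_eq0 (Om : set V) y r psi : local_defining Om y r psi ->
  bdry Om y -> ~ Om y -> psi y = 0.
Proof.
move=> [r0 C2 _ Opsi] [cly _] yO.
have yB : eball y r y by rewrite /eball /= subrr enorm0.
have [cpsi _ _] := C2_on_open (@open_eball _ _ y r) C2 yB.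
apply/eqP; rewrite eq_le; apply/andP; split; last first.
  by rewrite leNgt; apply/negP => h; apply: yO; apply/Opsi.
rewrite leNgt; apply/negP => h.
have N : nbhs y [set x | eball y r x /\ 0 < psi x].
  apply: (@filterI _ (nbhs y)); first by apply: open_nbhs_nbhs; split => //; exact: open_eball.
  exact: (cpsi _ (lt_nbhsr h)).
have [x [xO [xB xp]]] := cly _ N.
by have := (Opsi _ xB).1 xO; rewrite ltNge ltW.
Qed.

(* The competitor for the distance is [y + s a + s ^ 2 b e], with [b] chosen so that
   it stays just outside [Om], below the osculating paraboloid of the boundary. *)
Lemma competitor_bound (Om : set V) y r psi e a (g rho c eta : R) :
  ~` Om !=set0 -> local_defining Om y r psi -> psi y = 0 -> enorm e = 1 ->
  0 < g -> grad psi y = - g *: e -> 0 < rho -> dot a e = 0 -> 0 < eta ->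
  exists2 del, 0 < del & forall s, `|s| < del ->
    distc Om (y + rho *: e + s *: (a + c *: e)) <=
      rho + s * c - s ^+ 2 * (2^-1 * dot a (hess psi y a) / g - eta).
Proof.
move=> nO [r0 C2 _ Opsi] psi0 e1 g0 gradE rho0 ae eta0.
set Q := dot a (hess psi y a); set b := _ / g - eta.
have ee : dot e e = 1 by rewrite -enorm_sqr e1 expr1n.
(* The main part [eps s^2 |a|^2] of the Taylor error may then use up half of the margin [g eta s^2];
   the other half is left for the terms of higher order, gathered in [C]. *)
pose eps := g * eta / (2 * (dot a a + 1)).
have aa0 : 0 < dot a a + 1 by rewrite ltr_wpDl // dot_ge0.
have eps0 : 0 < eps by rewrite divr_gt0 ?mulr_gt0.
have epsa : eps * dot a a <= g * eta / 2.
  rewrite /eps -mulrA ler_wpM2l ?mulr_ge0 ?(ltW g0) ?(ltW eta0) //.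
  by rewrite invfM -mulrA ler_piMr ?invr_ge0 // mulrC ler_pdivrMr // mul1r lerDl.
have [del0 d0 T] := taylor2 r0 eps0 C2.
pose M := dot a (hess psi y e) + dot e (hess psi y a).
pose Qe := dot e (hess psi y e).
pose C := `|2^-1 * b * M| + `|2^-1 * b ^+ 2 * Qe| + eps * b ^+ 2.
pose D := enorm a + `|b|.
pose d1 := Num.min del0 r.
have d10 : 0 < d1 by rewrite lt_min d0 r0.
have C0 : 0 <= C.
  by apply: addr_ge0; [exact: addr_ge0 | rewrite mulr_ge0 ?sqr_ge0 ?(ltW eps0)].
have D0 : 0 <= D by rewrite addr_ge0 ?enorm_ge0.
(* The four bounds give [s^2 <= |s|], then [|s| C <= g eta / 2], then a point [y + k] inside the
   chart and the Taylor ball, and finally a nonnegative [rho + s c - s^2 b]. *)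
pose del := Num.min 1 (Num.min (g * eta / (2 * (C + 1)))
   (Num.min (d1 / (D + 1)) (rho / (`|c| + `|b| + 1)))).
exists del.
  have E1 : 0 < C + 1 by exact: ltr_wpDl.
  have E2 : 0 < D + 1 by exact: ltr_wpDl.
  have E3 : 0 < `|c| + `|b| + 1 by apply: ltr_wpDl => //; exact: addr_ge0.
  rewrite !lt_min ltr01 /=; apply/and3P; split; apply: divr_gt0 => //; exact: mulr_gt0.
move=> s; rewrite !lt_min => /andP[s1 /andP[s2 /andP[s3 s4]]].
have sn := normr_ge0 s.
rewrite ltr_pdivlMr ?mulr_gt0 ?ltr_wpDl // in s2.
rewrite ltr_pdivlMr ?ltr_wpDl // in s3.
rewrite ltr_pdivlMr ?ltr_wpDl ?addr_ge0 // in s4.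
have ss : s ^+ 2 = `|s| ^+ 2 by rewrite real_normK ?num_real.
have ss1 : s ^+ 2 <= `|s| by rewrite ss expr2 ler_piMl // ltW.
pose k := s *: a + (s ^+ 2 * b) *: e.
have kn : enorm k < d1.
  apply: le_lt_trans s3; apply: le_trans (enormD _ _) _.
  rewrite !enormZ e1 mulr1 normrM (ger0_norm (sqr_ge0 s)) /D.
  by have := normr_ge0 b; have := enorm_ge0 a; nra.
have kB : eball y r (y + k).
  by rewrite /eball /= addrC addKr; apply: lt_le_trans kn _; rewrite ge_min lexx orbT.
have ea : dot e a = 0 by rewrite dotC.
have kO : ~ Om (y + k).
  move=> /(Opsi _ kB).1; rewrite ltNge => /negP; apply.
  have := T k (lt_le_trans kn _); rewrite ge_min lexx => /(_ isT).
  rewrite psi0 subr0 gradE.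
  have -> : dot (- g *: e) k = - (g * (s ^+ 2 * b)).
    by rewrite /k dotDr !dotZr !dotZl ea ee; ring.
  have -> : dot k (hess psi y k) =
      s ^+ 2 * Q + s ^+ 3 * b * M + s ^+ 4 * b ^+ 2 * Qe.
    by rewrite /k hessD !hessZ !(dotDl, dotDr, dotZl, dotZr) -/Q -/Qe /M; ring.
  have -> : enorm k ^+ 2 = s ^+ 2 * dot a a + s ^+ 4 * b ^+ 2.
    by rewrite enorm_sqr /k !(dotDl, dotDr, dotZl, dotZr) ae ea ee; ring.
  rewrite ler_norml => /andP[+ _].
  (* The coefficient of [s^2] in [psi (y + k)]: subtracting [eta] in [b] leaves a strictly positive
     margin, which keeps the competitor outside [Om]. *)
  have gb : - (g * b) + 2^-1 * Q = g * eta by rewrite /b; field; rewrite gt_eqF.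
  have K : `|s * (2^-1 * b * M) + s ^+ 2 * (2^-1 * b ^+ 2 * Qe) - s ^+ 2 * (eps * b ^+ 2)|
     <= `|s| * C.
    apply: le_trans (ler_normB _ _) _; rewrite /C [leRHS]mulrDr; apply: lerD.
      apply: le_trans (ler_normD _ _) _; rewrite [leRHS]mulrDr; apply: lerD.
        by rewrite normrM.
      by rewrite normrM ler_wpM2r // (ger0_norm (sqr_ge0 s)).
    have eb : 0 <= eps * b ^+ 2 by exact: mulr_ge0 (ltW eps0) (sqr_ge0 b).
    by rewrite normrM (ger0_norm (sqr_ge0 s)) (ger0_norm eb) ler_wpM2r.
  rewrite ler_norml in K; case/andP: K => K _.
  move=> h.
  have key : 0 <= s ^+ 2 * (g * eta - eps * dot a a +
      (s * (2^-1 * b * M) + s ^+ 2 * (2^-1 * b ^+ 2 * Qe) - s ^+ 2 * (eps * b ^+ 2))).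
    rewrite mulr_ge0 ?sqr_ge0 //.
    have : `|s| * C <= g * eta / 2 by move: s2; nra.
    by lra.
  rewrite -gb in key; move: h key; nra.
have pos : 0 <= rho + s * c - s ^+ 2 * b.
  have h1 : - (`|s| * `|c|) <= s * c by rewrite -normrM lerNl -normrN; exact: ler_norm.
  have h2 : s ^+ 2 * b <= `|s| * `|b|.
    apply: (@le_trans _ _ (s ^+ 2 * `|b|)); first by rewrite ler_wpM2l ?sqr_ge0 ?ler_norm.
    by rewrite ler_wpM2r.
  by clear -h1 h2 s4 sn; clearbody b; lra.
apply: le_trans (distc_le nO _ kO) _.
(* The tangential shift [s a] of the competitor cancels that of the point, so the distance between
   them is exactly a quadratic in [s] and no square root has to be expanded. *)
have -> : y + rho *: e + s *: (a + c *: e) - (y + k) = (rho + s * c - s ^+ 2 * b) *: e.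
  by apply/rowP => i; rewrite !mxE; ring.
by rewrite enormZ e1 mulr1 ger0_norm.
Qed.

(* The ball around [x] touching the boundary at [y] lies in [{psi < 0}], so every
   direction pointing into it makes a nonpositive product with the gradient. *)
Lemma gradient_normal (Om : set V) x y r psi : open Om -> ~` Om !=set0 ->
  Om x -> ~ Om y -> distc Om x = enorm (x - y) -> local_defining Om y r psi ->
  psi y = 0 ->
  enorm (x - y) *: grad psi y = - enorm (grad psi y) *: (x - y).
Proof.
move=> oO nO xO yO dxy [r0 C2 _ Opsi] psi0.
have [u uE] : exists u, x - y = u by exists (x - y).
have [G GE] : exists G, grad psi y = G by exists (grad psi y).
rewrite uE GE; rewrite uE in dxy.
have u0 : 0 < enorm u by rewrite -dxy distc_gt0.
have G0 := enorm_ge0 G.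
(* The claim is [v = 0], the equality case of Cauchy-Schwarz for [- u] and [G]. Otherwise [v] would
   make positive products with [u] and with [G]: moving from [y] along [v] would enter the touching
   ball while [psi] increases from 0. *)
pose v := enorm u *: G + enorm G *: u.
have uv : dot u v = enorm u * (dot u G + enorm u * enorm G).
  by rewrite /v dotDr !dotZr -enorm_sqr; ring.
suff vv : dot v v <= 0.
  have : v = 0.
    by apply: enorm_eq0; apply/eqP; rewrite -sqrf_eq0 enorm_sqr eq_le vv dot_ge0.
  by rewrite /v => /eqP; rewrite addr_eq0 scaleNr => /eqP.
have vvE : dot v v = 2 * enorm u * enorm G * (dot u G + enorm u * enorm G).
  by rewrite /v !(dotDl, dotDr, dotZl, dotZr) -!enorm_sqr (dotC G u); ring.
have cs : 0 <= dot u G + enorm u * enorm G.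
  by have := dot_le_enorm (- u) G; rewrite dotNl enormN; lra.
have [z|/negbTE nz] := eqVneq (dot u G + enorm u * enorm G) 0; first by rewrite vvE z mulr0.
have pz : 0 < dot u G + enorm u * enorm G by rewrite lt_def nz cs.
have Gv : dot G v = enorm G * (dot u G + enorm u * enorm G).
  by rewrite /v dotDr !dotZr -enorm_sqr (dotC G u); ring.
clearbody v.
suff : dot G v <= 0 by rewrite Gv vvE; have := enorm_ge0 u; nra.
rewrite leNgt; apply/negP => Gv0.
have uv0 : 0 < dot u v by rewrite uv mulr_gt0.
have [del d0 T] := taylor2 r0 ltr01 C2.
pose C := `|2^-1 * dot v (hess psi y v)| + enorm v ^+ 2.
have C0 : 0 <= C by rewrite addr_ge0 // sqr_ge0.
(* The three bounds keep [y + t v] in the chart and the Taylor ball, make the linear growth of [psi]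
   beat the quadratic remainder, and place the point inside the ball about [x]. *)
pose t := Num.min (Num.min del r / (2 * (enorm v + 1)))
   (Num.min (dot G v / (2 * (C + 1))) (dot u v / (enorm v ^+ 2 + 1))).
have t0 : 0 < t.
  by rewrite !lt_min !divr_gt0 ?mulr_gt0 ?ltr_wpDl ?lt_min ?d0 ?sqr_ge0 ?enorm_ge0.
have t1 : t * (2 * (enorm v + 1)) <= Num.min del r.
  by rewrite -ler_pdivlMr ?mulr_gt0 ?ltr_wpDl ?enorm_ge0 // ge_min lexx.
have t2 : t * (2 * (C + 1)) <= dot G v.
  by rewrite -ler_pdivlMr ?mulr_gt0 ?ltr_wpDl // !ge_min lexx orbT.
have t3 : t * (enorm v ^+ 2 + 1) <= dot u v.
  by rewrite -ler_pdivlMr ?ltr_wpDl ?sqr_ge0 // !ge_min lexx !orbT.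
have tv : enorm (t *: v) < Num.min del r.
  apply: lt_le_trans t1; rewrite enormZ gtr0_norm //.
  by have := enorm_ge0 v; nra.
have inO : Om (y + t *: v).
  apply: (@eball_distc _ _ _ nO x); rewrite /eball /= dxy.
  rewrite -(@ltr_pXn2r _ 2) ?nnegrE ?enorm_ge0 //.
  have -> : y + t *: v - x = t *: v - u by rewrite -uE; apply/rowP => i; rewrite !mxE; ring.
  rewrite !enorm_sqr !(dotDl, dotDr, dotNl, dotNr, dotZl, dotZr) (dotC v u).
  rewrite -(enorm_sqr v); have := sqr_ge0 (enorm v); nra.
have tvB : eball y r (y + t *: v).
  by rewrite /eball /= addrC addKr; apply: lt_le_trans tv _; rewrite ge_min lexx orbT.
have := (Opsi _ tvB).1 inO.
have := T (t *: v) (lt_le_trans tv _); rewrite ge_min lexx => /(_ isT).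
rewrite psi0 subr0 mul1r dotZr hessZ dotZl dotZr enormZ exprMn (gtr0_norm t0) GE.
rewrite ler_norml => /andP[+ _].
have : - `|2^-1 * dot v (hess psi y v)| <= 2^-1 * dot v (hess psi y v).
  by rewrite lerNl -normrN ler_norm.
rewrite /C in t2 C0; have := normr_ge0 (2^-1 * dot v (hess psi y v)).
move: (`|_|) t2 C0 => q t2 C0 q0 qq h1 h2; nra.
Qed.

(** The normal enters quadratically, so the inward [e] may replace the outward normal; [2 <= n] lets
    the factor [n.-1] cancel. *)
Lemma mean_curvE psi y e g : (2 <= n)%N -> enorm e = 1 -> 0 < g ->
  grad psi y = - g *: e ->
  (n.-1)%:R * mean_curv_formula psi y =
  (\sum_(i < n) partial i (partial i psi) y - dot e (hess psi y e)) / g.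
Proof.
move=> n2 e1 g0 gradE.
have n1 : (n.-1)%:R != 0 :> R by rewrite pnatr_eq0; case: n n2 => [|[]].
have gi i : partial i psi y = - g * e 0 i by have /rowP/(_ i) := gradE; rewrite !mxE.
have S : \sum_(i < n) partial i psi y ^+ 2 = g ^+ 2.
  transitivity (g ^+ 2 * dot e e); last by rewrite -enorm_sqr e1 expr1n mulr1.
  by rewrite /dot mulr_sumr; apply: eq_bigr => i _; rewrite gi; ring.
have Q : \sum_(i < n) \sum_(j < n) partial i psi y * partial j psi y *
    partial j (partial i psi) y = g ^+ 2 * dot e (hess psi y e).
  rewrite /dot mulr_sumr; apply: eq_bigr => i _; rewrite mxE mulrA /dot mulr_sumr.
  by apply: eq_bigr => j _; rewrite !gi mxE; ring.
rewrite /mean_curv_formula S Q sqrtr_sqr (gtr0_norm g0) mulrCA mulfV // mulr1.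
by rewrite mulrAC mulfV ?mul1r // sqrf_eq0 gt_eqF.
Qed.

(** The trace on the tangent space is computed from the projections of the coordinate vectors
    instead of a tangential frame, because [dlap] uses exactly the coordinate directions. *)
Lemma sum_tangential_hess psi y e : enorm e = 1 ->
  \sum_(i < n) (let a := evec R i - e 0 i *: e in dot a (hess psi y a)) =
  \sum_(i < n) partial i (partial i psi) y - dot e (hess psi y e).
Proof.
move=> e1; have ee : dot e e = 1 by rewrite -enorm_sqr e1 expr1n.
transitivity (\sum_(i < n) (partial i (partial i psi) y
   - e 0 i * hess psi y e 0 i - e 0 i * dot e (hess psi y (evec R i))
   + e 0 i * e 0 i * dot e (hess psi y e))).
  apply: eq_bigr => i _ /=; rewrite -scaleNr hessD hessZ !(dotDl, dotDr, dotZl, dotZr).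
  rewrite ![dot (evec R i) _]dotC !dot_evec !mxE !dot_evec !mxE; ring.
rewrite !(big_split, sumrN) /= -mulr_suml ?sumrN -/(dot e (hess psi y e)) -/(dot e e) ee mul1r.
have -> : \sum_(i < n) e 0 i * dot e (hess psi y (evec R i)) = dot e (hess psi y e).
  transitivity (\sum_(i < n) \sum_(j < n) e 0 i * (e 0 j * partial i (partial j psi) y)).
    apply: eq_bigr => i _; rewrite /dot mulr_sumr; apply: eq_bigr => j _.
    by rewrite [hess _ _ _ _ _]mxE dot_evec mxE.
  rewrite exchange_big /dot; apply: eq_bigr => j _; rewrite [hess _ _ _ _ _]mxE /dot mulr_sumr.
  by apply: eq_bigr => i _; rewrite [grad _ _ _ _]mxE; ring.
ring.
Qed.

End DiscreteLaplacian.

(** * Discrete Laplacians and their weak limit *)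

Section DistanceLaplacian.
Context {R : realType} {n : nat}.
Local Notation V := 'rV[R]_n.
Implicit Types (f psi : V -> R) (x y z u v : V).

(** Each coordinate vector is split into a tangential part [a i] and a multiple of the normal.
    Adding the competitor bounds for [t] and [- t] cancels the linear terms, and the tangential
    quadratic forms add up to [g] times the sum of the principal curvatures. *)
Lemma dlap_distc_near (Om : set V) x (c eps : R) : (2 <= n)%N ->
  open Om -> ~` Om !=set0 -> C2_boundary Om -> Om x ->
  (forall y H, bdry Om y -> is_mean_curv Om y H -> c <= (n.-1)%:R * H) ->
  0 < eps ->
  exists2 del, 0 < del & forall t, 0 < t < del -> dlap t (distc Om) x <= eps - c.
Proof.
move=> n2 oO nO C2O xO cH eps0.
have [y yO dxy] := distc_attained nO oO x.
have yb := nearest_bdry nO oO xO yO dxy.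
have [r [psi ld]] := C2O y yb.
have psi0 := local_defining_eq0 ld yb yO.
have gn := gradient_normal oO nO xO yO dxy ld psi0.
have rho0 : 0 < distc Om x by exact: distc_gt0.
set rho := distc Om x in rho0 *.
pose e := rho^-1 *: (x - y).
have e1 : enorm e = 1.
  by rewrite /e enormZ -dxy -/rho normfV gtr0_norm // mulVf // gt_eqF.
pose g := enorm (grad psi y).
have g0 : 0 < g.
  rewrite /g lt_def enorm_ge0 andbT; apply/eqP => /enorm_eq0 G0.
  case: ld => _ _ [i /eqP pi] _; apply: pi.
  by have /rowP/(_ i) := G0; rewrite !mxE.
have gradE : grad psi y = - g *: e.
  have E : rho *: grad psi y = - g *: (x - y) by rewrite /rho dxy.
  by rewrite /e scalerA mulrC -scalerA -E scalerA mulVf ?scale1r // gt_eqF.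
have xE : x = y + rho *: e.
  by rewrite /e scalerA mulfV ?gt_eqF // scale1r addrC subrK.
have H : c <= (\sum_(i < n) partial i (partial i psi) y - dot e (hess psi y e)) / g.
  by rewrite -(mean_curvE n2 e1 g0 gradE); apply: (cH y) => //; exists r, psi.
rewrite -(sum_tangential_hess _ _ e1) /= in H.
have n0 : 0 < n%:R :> R by rewrite ltr0n (ltn_trans _ n2).
(* Each of the [n] directions loses [2 eta], in total [eps]. *)
pose eta := eps / (2 * n%:R).
have eta0 : 0 < eta by rewrite divr_gt0 ?mulr_gt0.
have ee : dot e e = 1 by rewrite -enorm_sqr e1 expr1n.
pose a (i : 'I_n) : V := evec R i - e 0 i *: e.
have ae i : dot (a i) e = 0.
  by rewrite /a dotDl dotNl dotZl ee dotC dot_evec mulr1 subrr.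
have aE i : a i + e 0 i *: e = evec R i by rewrite /a subrK.
have ex (i : 'I_n) : exists del, 0 < del /\ forall s, `|s| < del ->
    distc Om (x + s *: evec R i) <=
      rho + s * e 0 i - s ^+ 2 * (2^-1 * dot (a i) (hess psi y (a i)) / g - eta).
  have [del d0 hd] := competitor_bound (e 0 i) nO ld psi0 e1 g0 gradE rho0 (ae i) eta0.
  by exists del; split => // s /hd; rewrite -xE aE.
have /choice[D hD] := ex.
exists (\big[Num.min/1]_(i < n) D i).
  by apply: (@big_ind R (fun s => 0 < s)) => // [s t s0 t0|i _]; [rewrite lt_min s0 t0 | case: (hD i)].
move=> t /andP[t0 td].
rewrite /dlap ler_pdivrMl ?exprn_gt0 //.
apply: (@le_trans _ _ (\sum_(i < n) (- (t ^+ 2 * (dot (a i) (hess psi y (a i)) / g - 2 * eta))))).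
  apply: ler_sum => i _; have [_ hi] := hD i.
  have ti : `|t| < D i by rewrite gtr0_norm //; apply: lt_le_trans td _; exact: bigmin_le.
  have := hi t ti; have := hi (- t); rewrite normrN => /(_ ti).
  by rewrite scaleNr sqrrN -/rho; lra.
rewrite sumrN -mulr_sumr -mulrN ler_wpM2l ?sqr_ge0 // sumrB -mulr_suml sumr_const card_ord.
have -> : 2 * eta *+ n = eps.
  by rewrite -[LHS]mulr_natr /eta; field; rewrite gt_eqF.
by move: H; rewrite /a; lra.
Qed.

Lemma dlap_distc_le (Om : set V) t x : open Om -> ~` Om !=set0 -> 0 < t ->
  distc Om x * dlap t (distc Om) x <= n%:R.
Proof.
move=> oO nO t0; rewrite /dlap mulrCA ler_pdivrMl ?exprn_gt0 // mulr_sumr.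
apply: (@le_trans _ _ (\sum_(i < n) t ^+ 2)).
  apply: ler_sum => i _; apply: le_trans (distc_second_difference nO oO x (t *: evec R i)) _.
  by rewrite enormZ enorm_evec mulr1 real_normK ?num_real.
by rewrite sumr_const card_ord mulr_natr.
Qed.

Lemma continuous_sumr (F : 'I_n -> V -> R) :
  (forall i, continuous (F i)) -> continuous (fun x => \sum_(i < n) F i x).
Proof.
move=> cF; suff h s : continuous (fun x => \sum_(i <- s) F i x) by exact: h.
elim: s => [|i s IH].
  rewrite (_ : (fun _ => _) = (fun=> 0)); first exact: continuous_cst.
  by apply/funext => x; rewrite big_nil.
rewrite (_ : (fun _ => _) = (fun x => F i x + \sum_(j <- s) F j x)).
  exact: continuous_addr.
by apply/funext => x; rewrite big_cons.
Qed.

Lemma continuous_translate f v : continuous f -> continuous (fun x => f (x + v)).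
Proof.
by move=> cf x; apply: continuous_comp; [exact: shift_continuous | exact: cf].
Qed.

Lemma continuous_dlap f t : continuous f -> continuous (dlap t f).
Proof.
move=> cf; apply: continuous_mulr; first exact: continuous_cst.
apply: continuous_sumr => i; apply: continuous_subr; last first.
  by apply: continuous_mulr => //; exact: continuous_cst.
by apply: continuous_addr; exact: continuous_translate.
Qed.

Lemma CcS (A B : set V) f : A `<=` B -> Cc A f -> Cc B f.
Proof.
by move=> AB [cf [K [cK KA K0]]]; split => //; exists K; split => // x /KA /AB.
Qed.

Lemma CcT (A : set V) f : Cc A f -> Cc setT f.
Proof. exact: CcS. Qed.

(** The quotient is continuous on [Om], where [d] is positive. A point outside [Om] has a
    neighbourhood disjoint from [K], on which [f] and therefore the quotient vanish. *)
Lemma Cc_div (Om : set V) f : open Om -> ~` Om !=set0 -> Cc Om f ->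
  Cc Om (fun x => f x / distc Om x).
Proof.
move=> oO nO [cf [K [cK KO K0]]]; split; last first.
  by exists K; split => // x /K0 ->; rewrite mul0r.
move=> x; have [xO|xO] := pselect (Om x).
  apply: (@continuousM R V f (fun x => (distc Om x)^-1)); first exact: cf.
  apply: continuousV; last exact: distc_continuous.
  by rewrite gt_eqF // distc_gt0.
have oK : open (~` K) by apply: closed_openC; exact: compact_closed.
have N : nbhs x (~` K) by apply: open_nbhs_nbhs; split => // /KO.
rewrite /continuous_at K0 ?mul0r; last by move=> /KO.
apply: (@cvg_near_cst V R 0 (fun z => f z / distc Om z) (nbhs (x : V)) _ _); near=> z.
by rewrite K0 ?mul0r //; near: z; exact: N.
Unshelve. all: by end_near. Qed.

Definition bump (r : R) x : R := Num.max 0 (Num.min 1 (r + 1 - enorm x)).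

Lemma bump_ge0 r x : 0 <= bump r x.
Proof. by rewrite le_max lexx. Qed.

Lemma bump1 r x : enorm x <= r -> bump r x = 1.
Proof. by move=> h; rewrite /bump (@min_l _ _ 1) ?max_r //; lra. Qed.

Lemma bump_Cc r : Cc setT (bump r).
Proof.
split.
  apply: continuous_maxr; first exact: continuous_cst.
  apply: continuous_minr; first exact: continuous_cst.
  by apply: continuous_subr; [exact: continuous_cst | exact: enorm_continuous].
exists [set x | enorm x <= r + 1]; split => //.
  apply: (@bounded_compact _ _ _ (r + 1)) => //.
  apply: (@closed_comp _ _ (@enorm R n) [set s | s <= r + 1]) => [x _|].
    exact: enorm_continuous.
  exact: closed_le.
move=> x /= /negP; rewrite -ltNge => h; rewrite /bump max_l // ge_min; apply/orP; right; lra.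
Qed.

Lemma Cc_ball (A : set V) f : Cc A f ->
  exists2 r, 0 < r & forall x, r < enorm x -> f x = 0.
Proof.
move=> [cf [K [cK _ K0]]]; have [r r0 Kr] := compact_enorm cK.
by exists r => // x rx; apply: K0 => /Kr; rewrite leNgt rx.
Qed.

Variable lam : {measure set (Rn R n) -> \bar R}.
Hypothesis lamP : is_lebesgue lam.
Local Notation I := (Rintegral lam setT).

Lemma le_lebesgue_integral f g : Cc setT f -> Cc setT g -> (forall x, f x <= g x) -> I f <= I g.
Proof. by move=> fC gC fg; apply: le_Rintegral => //; exact: lebesgue_integrable. Qed.

Lemma norm_lebesgue_integral_le f g : Cc setT f -> Cc setT g -> (forall x, `|f x| <= g x) -> `|I f| <= I g.
Proof.
move=> fC gC fg; rewrite ler_norml; apply/andP; split.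
  rewrite lerNl -mulN1r -RintegralZl //; last exact: lebesgue_integrable.
  apply: le_lebesgue_integral => //; first exact: CcZ.
  by move=> x; rewrite mulN1r; apply: le_trans (fg x); rewrite -normrN ler_norm.
by apply: le_lebesgue_integral => // x; apply: le_trans (fg x); exact: ler_norm.
Qed.

Lemma dominated_cvg_Cc (F : nat -> V -> R) f g :
  (forall k, Cc setT (F k)) -> Cc setT f -> Cc setT g ->
  (forall x, (F k x) @[k --> \oo] --> f x) -> (forall k x, `|F k x| <= g x) ->
  (I (F k)) @[k --> \oo] --> I f.
Proof.
move=> FC fC gC Ff Fg.
have [|||||_ _ h] := @dominated_convergence _ (Rn R n) R lam setT measurableT
  (fun k x => (F k x)%:E) (fun x => (f x)%:E) (fun x => (g x)%:E).
- by move=> k; apply/measurable_EFinP; apply: measurable_continuous; case: (FC k).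
- by apply/measurable_EFinP; apply: measurable_continuous; case: fC.
- by apply: aeW => x _; apply: cvg_EFin; [exact: nearW | exact: Ff].
- exact: lebesgue_integrable.
- by apply: aeW => x k _; rewrite lee_fin.
have fin q : Cc setT q -> (\int[lam]_x (q x)%:E)%E = (I q)%:E.
  by move=> qC; rewrite /Rintegral fineK // integrable_fin_num //; exact: lebesgue_integrable.
by move: h; rewrite fin // => /fine_cvgP[_].
Qed.

End DistanceLaplacian.

(** * Limits along an ultrafilter, and discrete Laplacians of test functions *)

Section WeakLimit.
Context {R : realType} {n : nat}.
Local Notation V := 'rV[R]_n.
Implicit Types (f g phi psi chi : V -> R) (x y z u v : V).

Lemma ultra_bounded_cvg (U : set_system nat) (a : nat -> R) (M : R) : UltraFilter U ->
  (forall k, `|a k| <= M) -> exists l : R, a @ U --> l.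
Proof.
move=> UU aM.
have UP : ProperFilter U by exact: ultra_proper.
have ua : UltraFilter (a @ U).
  split => [|G GP aG]; first exact: fmap_proper_filter.
  apply/seteqP; split => // A GA.
  have [//|UA] := in_ultra_setVsetC (a @^-1` A) UU.
  have /filter_ex[x [Ax nAx]] : G (A `&` ~` A) by apply: filterI => //; exact: aG.
  by [].
have cpt : compact `[(- M : R), M] by exact: segment_compact.
rewrite compact_ultra in cpt.
have [|l [_ al]] := cpt _ ua; last by exists l.
by apply: (@filterE _ U) => k /=; rewrite in_itv /= -ler_norml.
Qed.

Lemma CcSum (A : set V) (J : Type) (s : seq J) (F : J -> V -> R) :
  (forall j, Cc A (F j)) -> Cc A (fun x => \sum_(j <- s) F j x).
Proof.
move=> FC; elim: s => [|j s IH].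
  rewrite (_ : (fun _ => _) = (fun=> 0)); first exact: Cc0.
  by apply/funext => x; rewrite big_nil.
rewrite (_ : (fun _ => _) = (fun x => F j x + \sum_(i <- s) F i x)); first exact: CcD.
by apply/funext => x; rewrite big_cons.
Qed.

Lemma positive_linear_sum (A : set V) L (J : Type) (s : seq J) (F : J -> V -> R) :
  positive_linear A L -> (forall j, Cc A (F j)) ->
  L (fun x => \sum_(j <- s) F j x) = \sum_(j <- s) L (F j).
Proof.
move=> Lp FC; elim: s => [|j s IH].
  rewrite big_nil -[RHS](positive_linear0 Lp); congr L.
  by apply/funext => x; rewrite big_nil.
rewrite big_cons -IH; case: (Lp) => LD _ _; rewrite -LD //; last exact: CcSum.
by congr L; apply/funext => x; rewrite big_cons.
Qed.

Lemma cvg_sumr (J : Type) (s : seq J) (F : J -> nat -> R) (l : J -> R) :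
  (forall j, F j @ \oo --> l j) ->
  (fun k => \sum_(j <- s) F j k) @ \oo --> \sum_(j <- s) l j.
Proof.
move=> Fl; elim: s => [|j s IH].
  rewrite big_nil (_ : (fun _ => _) = (fun=> 0)); first exact: cvg_cst.
  by apply/funext => x; rewrite big_nil.
rewrite big_cons (_ : (fun _ => _) = (fun k => F j k + \sum_(i <- s) F i k)).
  exact: cvgD.
by apply/funext => x; rewrite big_cons.
Qed.

(** The steps never exceed 1, so differences enlarge a ball containing the support by at most 1 and
    a single [bump] dominates them for all [k]. *)
Definition mesh (k : nat) : R := k.+1%:R^-1.

Lemma mesh_gt0 k : 0 < mesh k. Proof. by rewrite invr_gt0. Qed.

Lemma mesh_le1 k : mesh k <= 1. Proof. by rewrite invf_le1 // ler1n. Qed.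

Lemma near_mesh (del : R) : 0 < del -> \forall k \near \oo, mesh k < del.
Proof.
move=> d0; near=> k.
have : (del^-1 < k%:R :> R) by near: k; exact: nbhs_infty_gtr.
move=> h; rewrite /mesh -[del]invrK ltf_pV2 ?posrE ?invr_gt0 //.
by apply: lt_trans h _; rewrite ltr_nat.
Unshelve. all: by end_near. Qed.

Section TestFunction.
Variable phi : V -> R.
Hypothesis sphi : smooth phi.

Let second i := partial i (partial i phi).

Lemma smooth_second_difference x (i : 'I_n) (c M h : R) : 0 < h ->
  (forall t, `|t| <= h -> `|second i (x + t *: evec R i) - c| <= M) ->
  `|h ^- 2 * (phi (x + h *: evec R i) + phi (x - h *: evec R i) - 2 * phi x) - c| <= 2 * M.
Proof.
move=> h0 hM.
have d1 (t : R) : is_derive t 1 (fun t => phi (x + t *: evec R i)) (partial i phi (x + t *: evec R i)).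
  by apply: is_derive_line; case: (sphi [::]).
have d2 (t : R) : is_derive t 1 (fun t => partial i phi (x + t *: evec R i)) (second i (x + t *: evec R i)).
  by apply: is_derive_line; case: (sphi [:: i]).
have := second_difference_le (ltW h0) d1 d2 hM.
rewrite scale0r addr0 scaleNr.
have h2 : 0 < h ^+ 2 by rewrite exprn_gt0.
set D := (X in _ * X - _); move=> h3.
have -> : h ^- 2 * D - c = h ^- 2 * (D - c * h ^+ 2) by field; rewrite gt_eqF.
by rewrite normrM gtr0_norm ?invr_gt0 // mulrC ler_pdivrMr.
Qed.

Lemma dlap_cvg x : (fun k => dlap (mesh k) phi x) @ \oo --> laplacian phi x.
Proof.
rewrite (_ : (fun _ => _) = (fun k => \sum_(i < n) (mesh k) ^- 2 *
   (phi (x + mesh k *: evec R i) + phi (x - mesh k *: evec R i) - 2 * phi x))); last first.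
  by apply/funext => k; rewrite /dlap mulr_sumr.
apply: cvg_sumr => i; apply/cvgrPdist_le => e e0.
have e2 : 0 < e / 2 by rewrite divr_gt0.
have c2 : {for x, continuous (second i)} by case: (sphi [:: i; i]) => + _; apply.
have [del d0 hd] : exists2 del, 0 < del & forall y, enorm (y - x) < del ->
    `|second i y - second i x| < e / 2.
  apply: (@nbhs_eball _ _ x (fun y => `|second i y - second i x| < e / 2)).
  have h := (@cvgrPdist_lt _ _ _ (nbhs x) _ _ _).1 c2 _ e2.
  apply: (@filterS _ (nbhs x) _ _ _ _ (h _)) => y hy.
  rewrite distrC.
  exact: hy.
near=> k.
rewrite distrC -[leRHS](@divfK _ 2) // [leRHS]mulrC.
apply: smooth_second_difference; first exact: mesh_gt0.
move=> t tk; apply: ltW; apply: hd.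
rewrite addrC addKr enormZ enorm_evec mulr1; apply: le_lt_trans tk _.
by near: k; exact: near_mesh.
Unshelve. all: by end_near. Qed.

Variable r : R.
Hypothesis r0 : 0 < r.
Hypothesis phir : forall x, r < enorm x -> phi x = 0.

Lemma dlap_out x h : 0 < h <= 1 -> r + 1 < enorm x -> dlap h phi x = 0.
Proof.
move=> /andP[h0 h1] rx; rewrite /dlap big1 ?mulr0 // => i _.
have out t : `|t| <= 1 -> phi (x + t *: evec R i) = 0.
  move=> t1; apply: phir; have := enormD (x + t *: evec R i) (- (t *: evec R i)).
  by rewrite addrK enormN enormZ enorm_evec mulr1; lra.
rewrite -scaleNr !out ?normrN ?gtr0_norm //.
by rewrite phir ?mulr0 ?subr0 ?addr0 //; lra.
Qed.

Lemma laplacian_Cc : Cc setT (laplacian phi).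
Proof.
split.
  apply: continuous_sumr => i; by case: (sphi [:: i; i]).
exists [set x | enorm x <= r + 1]; split => //.
  apply: (@bounded_compact _ _ _ (r + 1)) => //.
  apply: (@closed_comp _ _ (@enorm R n) [set s | s <= r + 1]) => [x _|].
    exact: enorm_continuous.
  exact: closed_le.
move=> x /= /negP; rewrite -ltNge => rx.
(* Here all the discrete Laplacians vanish, hence so does their limit. *)
have := @dlap_cvg x; rewrite (_ : (fun _ => _) = (fun=> 0)).
  by move=> /(cvg_lim (@Rhausdorff R)) <-; rewrite lim_cst.
by apply/funext => k; rewrite dlap_out // mesh_gt0 mesh_le1.
Qed.

Lemma dlap_bounded : exists M, forall h x, 0 < h <= 1 -> `|dlap h phi x| <= M * bump (r + 1) x.
Proof.
have ex (i : 'I_n) : exists M, forall x, enorm x <= r + 2 -> `|second i x| <= M.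
  have [|M [_ hM]] := @compact_bounded R R (second i @` [set x | enorm x <= r + 2]).
    apply: continuous_compact.
      by apply: continuous_subspaceT; case: (sphi [:: i; i]).
    apply: (@bounded_compact _ _ _ (r + 2)) => //.
    apply: (@closed_comp _ _ (@enorm R n) [set s | s <= r + 2]) => [x _|].
      exact: enorm_continuous.
    exact: closed_le.
  exists (`|M| + 1) => x xr; apply: (hM (`|M| + 1)); last by exists x.
  by rewrite (le_lt_trans (ler_norm _)) ?ltrDl.
have /choice[M hM] := ex.
exists (\sum_(i < n) 2 * M i) => h x h01.
have [h0 h1] := andP h01.
have [xr|xr] := leP (enorm x) (r + 1); last first.
  rewrite dlap_out // normr0 mulr_ge0 ?bump_ge0 //; apply: sumr_ge0 => i _.
  rewrite mulr_ge0 //; apply: le_trans (hM i 0 _); first exact: normr_ge0.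
  by rewrite enorm0 addr_ge0 // ltW.
rewrite bump1 // mulr1 /dlap mulr_sumr; apply: le_trans (ler_norm_sum _ _ _) _.
apply: ler_sum => i _.
have := @smooth_second_difference x i 0 (M i) h h0; rewrite subr0; apply => t th.
rewrite subr0; apply: hM; apply: le_trans (enormD _ _) _.
by rewrite enormZ enorm_evec mulr1; lra.
Qed.

End TestFunction.

End WeakLimit.

(** * Summation by parts under the Lebesgue integral *)

Section WeakLimitIntegral.
Context {R : realType} {n : nat}.
Local Notation V := 'rV[R]_n.
Implicit Types (f g phi psi chi : V -> R) (x y z u v : V).
Variable lam : {measure set (Rn R n) -> \bar R}.
Hypothesis lamP : is_lebesgue lam.
Local Notation I := (Rintegral lam setT).

Lemma lebesgue_positive_linear : positive_linear setT I.
Proof.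
split.
- by move=> f g fC gC; rewrite RintegralD //; exact: lebesgue_integrable.
- by move=> c f fC; rewrite RintegralZl //; exact: lebesgue_integrable.
- by move=> f _ f0; apply: Rintegral_ge0.
Qed.

Lemma Cc_dlap (A : set V) f t : Cc A f -> Cc setT (dlap t f).
Proof.
move=> fC; have fT := CcT fC.
apply: CcZ; apply: CcSum => i; apply: CcB; last exact: CcZ.
by apply: CcD; apply: Cc_shift.
Qed.

(** Translation invariance trades a shift of [g] by [v] for a shift of [f] by [- v], and the
    discrete Laplacian uses both signs alike. *)
Lemma integral_dlap_sym f g t : Cc setT f -> continuous g ->
  I (fun x => f x * dlap t g x) = I (fun x => g x * dlap t f x).
Proof.
move=> fC cg.
have sh v : I (fun x => f x * g (x + v)) = I (fun x => g x * f (x - v)).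
  rewrite -(Rintegral_shift lamP (- v)); last by apply: CcM => //; exact: continuous_translate.
  by congr Rintegral; apply/funext => x; rewrite subrK mulrC.
have [ID IZ _] := lebesgue_positive_linear.
have gf v : Cc setT (fun x => g x * f (x + v)).
  rewrite (_ : (fun _ => _) = (fun x => f (x + v) * g x)); first exact: CcM (Cc_shift v fC) cg.
  by apply/funext => x; rewrite mulrC.
have fg v : Cc setT (fun x => f x * g (x + v)) by apply: CcM => //; exact: continuous_translate.
transitivity (t ^- 2 * \sum_(i < n) (I (fun x => f x * g (x + t *: evec R i)) +
    I (fun x => f x * g (x + - (t *: evec R i))) - 2 * I (fun x => f x * g x))).
  have fg0 : Cc setT (fun x => f x * g x) by exact: CcM.
  have -> : (fun x => f x * dlap t g x) = (fun x => t ^- 2 * \sum_(i < n)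
      ((f x * g (x + t *: evec R i) + f x * g (x + - (t *: evec R i))) - 2 * (f x * g x))).
    apply/funext => x; rewrite /dlap mulrCA; congr (_ * _); rewrite mulr_sumr.
    by apply: eq_bigr => i _; ring.
  have tC (i : 'I_n) : Cc setT (fun x =>
      (f x * g (x + t *: evec R i) + f x * g (x + - (t *: evec R i))) - 2 * (f x * g x)).
    by apply: CcB; [exact: CcD | exact: CcZ].
  rewrite IZ; last exact: CcSum.
  rewrite (positive_linear_sum _ lebesgue_positive_linear) //; congr (_ * _); apply: eq_bigr => i _.
  by rewrite (positive_linearB lebesgue_positive_linear) ?ID ?IZ //; [exact: CcD | exact: CcZ].
have gf0 : Cc setT (fun x => g x * f x).
  by have := gf 0; congr Cc; apply/funext => x; rewrite addr0.
have -> : (fun x => g x * dlap t f x) = (fun x => t ^- 2 * \sum_(i < n)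
    ((g x * f (x + t *: evec R i) + g x * f (x + - (t *: evec R i))) - 2 * (g x * f x))).
  apply/funext => x; rewrite /dlap mulrCA; congr (_ * _); rewrite mulr_sumr.
  by apply: eq_bigr => i _; ring.
have tC (i : 'I_n) : Cc setT (fun x =>
    (g x * f (x + t *: evec R i) + g x * f (x + - (t *: evec R i))) - 2 * (g x * f x)).
  by apply: CcB; [exact: CcD | exact: CcZ].
rewrite IZ; last exact: CcSum.
rewrite (positive_linear_sum _ lebesgue_positive_linear) //; congr (_ * _); apply: eq_bigr => i _.
rewrite (positive_linearB lebesgue_positive_linear) ?ID ?IZ //; [|exact: CcD | exact: CcZ].
rewrite !sh opprK [X in X - _]addrC; congr (_ - _ * _).
by congr Rintegral; apply/funext => x; rewrite mulrC.
Qed.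

(* Discrete integration by parts: it is what keeps the approximating functionals
   bounded as [t] tends to [0] when [chi] and [g] are merely Lipschitz. *)
Lemma integral_second_difference chi g v : Cc setT chi -> continuous g ->
  I (fun x => chi x * (g (x + v) + g (x - v) - 2 * g x)) =
  - I (fun x => (chi (x + v) - chi x) * (g (x + v) - g x)).
Proof.
move=> cC cg.
have cd w : continuous (fun x => g (x + w) - g x).
  by apply: continuous_subr => //; exact: continuous_translate.
have cd' : continuous (fun x => g x - g (x - v)).
  by apply: continuous_subr => //; exact: continuous_translate.
have C1 : Cc setT (fun x => chi x * (g (x + v) - g x)) by exact: CcM.
have C2 : Cc setT (fun x => chi x * (g x - g (x - v))) by exact: CcM.
have C3 : Cc setT (fun x => chi (x + v) * (g (x + v) - g x)).
  by apply: CcM => //; exact: Cc_shift.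
have -> : (fun x => chi x * (g (x + v) + g (x - v) - 2 * g x)) =
  (fun x => chi x * (g (x + v) - g x) - chi x * (g x - g (x - v))).
  by apply/funext => x; ring.
have -> : (fun x => (chi (x + v) - chi x) * (g (x + v) - g x)) =
  (fun x => chi (x + v) * (g (x + v) - g x) - chi x * (g (x + v) - g x)).
  by apply/funext => x; ring.
rewrite !(positive_linearB lebesgue_positive_linear) // opprB; congr (_ - _).
rewrite -(Rintegral_shift lamP v C2); congr Rintegral.
by apply/funext => x; rewrite addrK.
Qed.

(** After summation by parts the integrand is a product of two increments, at most [c t] and [t],
    which cancels the factor [t^-2]. It vanishes outside the ball of radius [r + 1]. *)
Lemma integral_dlap_bounded chi g c : Cc setT chi -> 0 <= c -> lipschitz_const c chi ->
  lipschitz_const 1 g ->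
  exists M, forall t, 0 < t <= 1 -> `|I (fun x => chi x * dlap t g x)| <= M.
Proof.
move=> cC c0 lc lg.
have cg : continuous g by exact: lip_continuous lg.
have [r r0 cr] := Cc_ball cC.
have [_ IZ _] := lebesgue_positive_linear.
exists (n%:R * (c * I (bump (r + 1)))) => t /andP[t0 t1].
have t2 : 0 < t ^+ 2 by rewrite exprn_gt0.
pose q (i : 'I_n) x := chi x * (g (x + t *: evec R i) + g (x - t *: evec R i) - 2 * g x).
have qC i : Cc setT (q i).
  apply: CcM => //; apply: continuous_subr.
    by apply: continuous_addr; exact: continuous_translate.
  by apply: continuous_mulr => //; exact: continuous_cst.
have -> : (fun x => chi x * dlap t g x) = (fun x => t ^- 2 * \sum_(i < n) q i x).
  by apply/funext => x; rewrite /dlap mulrCA; congr (_ * _); rewrite mulr_sumr.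
rewrite IZ; last exact: CcSum.
rewrite (positive_linear_sum _ lebesgue_positive_linear) // normrM gtr0_norm ?invr_gt0 //.
rewrite ler_pdivrMl //; apply: le_trans (ler_norm_sum _ _ _) _.
apply: (@le_trans _ _ (\sum_(i < n) t ^+ 2 * (c * I (bump (r + 1))))); last first.
  by rewrite sumr_const card_ord -[leLHS]mulr_natl; rewrite le_eqVlt; apply/orP; left; apply/eqP; ring.
apply: ler_sum => i _; rewrite integral_second_difference // normrN.
rewrite -IZ; last exact: bump_Cc.
rewrite -IZ; last by apply: CcZ; exact: bump_Cc.
have te : enorm (t *: evec R i) = t by rewrite enormZ enorm_evec mulr1 gtr0_norm.
apply: (norm_lebesgue_integral_le lamP).
- apply: CcM; first by apply: CcB => //; exact: Cc_shift.
  by apply: continuous_subr => //; exact: continuous_translate.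
- by do 2 apply: CcZ; exact: bump_Cc.
move=> x; have [xr|xr] := leP (enorm x) (r + 1).
  rewrite bump1 // mulr1 normrM.
  have := lc (x + t *: evec R i) x; have := lg (x + t *: evec R i) x.
  rewrite [X in enorm X]addrC addKr te mul1r => h1 h2.
  by rewrite expr2 -mulrA mulrC [t * c]mulrC; apply: ler_pM.
rewrite (cr x); last by lra.
rewrite (cr (x + _)); last first.
  by have := enormD (x + t *: evec R i) (- (t *: evec R i)); rewrite addrK enormN te; lra.
by rewrite subrr mul0r normr0 !mulr_ge0 ?bump_ge0 // ltW.
Qed.

End WeakLimitIntegral.

(** * The approximating functionals of the distance and their limit *)

Section DistanceFunctional.
Context {R : realType} {n : nat}.
Local Notation V := 'rV[R]_n.
Implicit Types (f g phi psi chi : V -> R) (x y z u v : V).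
Variable Om : set V.
Hypotheses (oOm : open Om) (nOm : ~` Om !=set0).
Variable lam : {measure set (Rn R n) -> \bar R}.
Hypothesis lamP : is_lebesgue lam.
Local Notation I := (Rintegral lam setT).
Local Notation d := (distc Om).

Let I_linear := lebesgue_positive_linear lamP.

Lemma distc_lipschitz : lipschitz_const 1 d.
Proof. by move=> x y; rewrite mul1r; exact: distc_lip. Qed.

Let cd : continuous d. Proof. exact: distc_continuous. Qed.

(* [psi * (n / d - dlap t d)], nonnegative for [psi >= 0] since [d * dlap t d <= n];
   off [Om] it vanishes because [d x = 0] and [x / 0 = 0]. *)
Definition discrete_density t psi x : R := n%:R * (psi x / d x) - psi x * dlap t d x.

Lemma discrete_density_Cc t psi : Cc Om psi -> Cc Om (discrete_density t psi).
Proof.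
move=> pC; apply: CcB; first by apply: CcZ; exact: Cc_div.
by apply: CcM => //; exact: continuous_dlap.
Qed.

Lemma discrete_density_ge0 t psi x : 0 < t -> Cc Om psi -> (forall y, 0 <= psi y) -> 0 <= discrete_density t psi x.
Proof.
move=> t0 pC p0; rewrite /discrete_density.
have [xO|xO] := pselect (Om x); last first.
  by case: pC => _ [K [_ KO ->]]; [rewrite !mul0r mulr0 subr0 | move=> /KO].
have dx : 0 < d x by exact: distc_gt0.
have h : dlap t d x <= n%:R / d x.
  by rewrite ler_pdivlMr // mulrC; exact: dlap_distc_le.
by rewrite subr_ge0 [leRHS]mulrCA ler_wpM2l.
Qed.

Lemma discrete_density_split t psi : Cc Om psi ->
  I (discrete_density t psi) = n%:R * I (fun x => psi x / d x) - I (fun x => psi x * dlap t d x).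
Proof.
move=> pC; have [_ IZ _] := I_linear.
have C1 := CcT (Cc_div oOm nOm pC).
have C2 : Cc setT (fun x => psi x * dlap t d x).
  by apply: CcM; [exact: CcT pC | exact: continuous_dlap].
by rewrite (positive_linearB I_linear) ?IZ //; exact: CcZ.
Qed.

Lemma discrete_density_linear t : 0 < t -> positive_linear Om (fun psi => I (discrete_density t psi)).
Proof.
move=> t0; have [ID IZ I0] := I_linear; split.
- move=> f g fC gC; rewrite -ID; [|exact: CcT (discrete_density_Cc t fC)|exact: CcT (discrete_density_Cc t gC)].
  by congr Rintegral; apply/funext => x; rewrite /discrete_density; ring.
- move=> c f fC; rewrite -IZ; last exact: CcT (discrete_density_Cc t fC).
  by congr Rintegral; apply/funext => x; rewrite /discrete_density; ring.
- move=> f fC f0; apply: I0; first exact: CcT (discrete_density_Cc t fC).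
  by move=> x; exact: discrete_density_ge0.
Qed.

Lemma discrete_density_bounded psi : Cc Om psi ->
  exists M, forall t, 0 < t <= 1 -> `|I (discrete_density t psi)| <= M.
Proof.
move=> pC; have [c c0 pc] := Cc_bounded pC.
have [_ [K [cK KO K0]]] := pC.
have [chi [l [cC chi01 chi1 l0 lchi]]] := cutoff oOm nOm cK KO.
have [M hM] := integral_dlap_bounded lamP (CcT cC) l0 lchi distc_lipschitz.
exists (c * (n%:R * I (fun x => chi x / d x) + M)) => t t01.
have [t0 _] := andP t01.
have [_ AZ _] := discrete_density_linear t0.
have pchi x : - (c * chi x) <= psi x <= c * chi x.
  rewrite -ler_norml; have [xK|/K0 ->] := pselect (K x); first by rewrite chi1 // mulr1.
  by rewrite normr0 mulr_ge0 ?(ltW c0) //; case/andP: (chi01 x).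
have A1 : I (discrete_density t psi) <= c * I (discrete_density t chi).
  rewrite -AZ //; apply: (le_positive_linear (discrete_density_linear t0)) => //; first exact: CcZ.
  by move=> x; case/andP: (pchi x).
have A2 : - c * I (discrete_density t chi) <= I (discrete_density t psi).
  rewrite -AZ //; apply: (le_positive_linear (discrete_density_linear t0)) => //; first exact: CcZ.
  by move=> x; case/andP: (pchi x) => + _; rewrite mulNr.
have A3 : c * I (discrete_density t chi) <= c * (n%:R * I (fun x => chi x / d x) + M).
  rewrite ler_wpM2l ?(ltW c0) // discrete_density_split // lerD2l.
  by have := hM t t01; rewrite ler_norml => /andP[h _]; lra.
by rewrite ler_norml; apply/andP; split; lra.
Qed.

(* [L] is the limit along an ultrafilter; the second clause is all that is needed
   of it, and it pins [L] down wherever the sequence converges. *)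
Lemma ex_weak_limit : exists L, positive_linear Om L /\
  forall psi (b : nat -> R) l, Cc Om psi -> b @ \oo --> l ->
    (forall k, b k <= I (discrete_density (mesh k) psi)) -> l <= L psi.
Proof.
have [U [UU oU]] := ultraFilterLemma (eventually_filter).
have UP : ProperFilter U by exact: ultra_proper.
have ex psi : exists l : R, Cc Om psi -> (fun k => I (discrete_density (mesh k) psi)) @ U --> l.
  (* The value 0 is a mere default that makes [L] total; only its values on [Cc Om] matter. *)
  have [pC|pC] := pselect (Cc Om psi); last by exists 0.
  have [M hM] := discrete_density_bounded pC.
  have [k|l hl] := @ultra_bounded_cvg R U (fun k => I (discrete_density (mesh k) psi)) M UU.
    by apply: hM; rewrite mesh_gt0 mesh_le1.
  by exists l.
have /choice[L hL] := ex.
have uniq (a : nat -> R) (l l' : R) : a @ U --> l -> a @ U --> l' -> l = l'.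
  by move=> al al'; exact: (cvg_unique (@Rhausdorff R) al al').
exists L; split.
  split.
  - move=> f g fC gC; apply: uniq (hL _ (CcD fC gC)) _.
    have -> : (fun k => I (discrete_density (mesh k) (fun x => f x + g x))) =
        (fun k => I (discrete_density (mesh k) f) + I (discrete_density (mesh k) g)).
      by apply/funext => k; case: (discrete_density_linear (mesh_gt0 k)) => -> .
    by apply: cvgD; exact: hL.
  - move=> c f fC; apply: uniq (hL _ (CcZ c fC)) _.
    have -> : (fun k => I (discrete_density (mesh k) (fun x => c * f x))) =
        (fun k => c * I (discrete_density (mesh k) f)).
      by apply/funext => k; case: (discrete_density_linear (mesh_gt0 k)) => _ -> .
    by apply: cvgM; [exact: cvg_cst | exact: hL].
  - move=> f fC f0; apply: (ler_cvg_to (cvg_cst (0 : R)) (hL f fC)).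
    by apply: nearW => k; case: (discrete_density_linear (mesh_gt0 k)) => _ _; apply.
move=> psi b l pC bl bA.
have bU : b @ U --> l by apply: cvg_trans bl => A /= bA'; exact: oU.
apply: (ler_cvg_to bU (hL _ pC)); exact: nearW.
Qed.

Lemma discrete_density_test phi : test_fun Om phi ->
  (fun k => I (discrete_density (mesh k) phi)) @ \oo -->
    n%:R * I (fun x => phi x / d x) - I (fun x => d x * laplacian phi x).
Proof.
move=> [sphi cphi].
have pC : Cc Om phi by split => //; case: (sphi [::]).
have [r r0 pr] := Cc_ball pC.
have [M hM] := dlap_bounded sphi r0 pr.
rewrite (_ : (fun _ => _) = (fun k => n%:R * I (fun x => phi x / d x) -
    I (fun x => d x * dlap (mesh k) phi x))); last first.
  by apply/funext => k; rewrite discrete_density_split // (integral_dlap_sym lamP _ (CcT pC)).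
apply: cvgB; first exact: cvg_cst.
have dC f : Cc setT f -> Cc setT (fun x => d x * f x).
  move=> fC; have := CcM fC cd.
  by congr Cc; apply/funext => x; rewrite mulrC.
apply: (dominated_cvg_Cc lamP (g := fun x => d x * (M * bump (r + 1) x))).
- by move=> k; apply: dC; exact: Cc_dlap pC.
- by apply: (dC (laplacian phi)); apply: laplacian_Cc sphi _ pr.
- by apply: dC; apply: CcZ; exact: bump_Cc.
- by move=> x; apply: cvgM; [exact: cvg_cst | exact: dlap_cvg].
- move=> k x; rewrite normrM ger0_norm ?distc_ge0 // ler_wpM2l ?distc_ge0 //.
  by apply: hM; rewrite mesh_gt0 mesh_le1.
Qed.

(** Off [Om], where [d = 0], division by zero leaves [max 0 c]. This is harmless: the density is
    multiplied by functions vanishing off [Om] or integrated over subsets of [Om]. *)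
Definition curv_density c x : R := Num.max 0 (n%:R / d x + c).

Lemma curv_density_Cc c psi : Cc Om psi -> (forall x, 0 <= psi x) ->
  Cc Om (fun x => psi x * curv_density c x).
Proof.
move=> pC p0.
have -> : (fun x => psi x * curv_density c x) =
    (fun x => Num.max (n%:R * (psi x / d x) + c * psi x) 0).
  apply/funext => x; rewrite /curv_density maxr_pMr // mulr0 maxC; congr Num.max; ring.
by apply: Cc_max0; apply: CcD; apply: CcZ => //; exact: Cc_div.
Qed.

(* Fatou's lemma, in the form of dominated convergence of the truncations. *)
Lemma weak_limit_ge L c psi : 
  (forall psi (b : nat -> R) l, Cc Om psi -> b @ \oo --> l ->
    (forall k, b k <= I (discrete_density (mesh k) psi)) -> l <= L psi) ->
  (forall x (eps : R), Om x -> 0 < eps -> exists2 del, 0 < del &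
     forall t, 0 < t < del -> dlap t d x <= eps - c) ->
  Cc Om psi -> (forall x, 0 <= psi x) ->
  I (fun x => psi x * curv_density c x) <= L psi.
Proof.
move=> hL hc pC p0.
have GC := curv_density_Cc c pC p0.
set G := (fun x => psi x * curv_density c x) in GC *.
have G0 x : 0 <= G x by rewrite mulr_ge0 // le_max lexx.
pose F k x := Num.min (G x) (discrete_density (mesh k) psi x).
have FC k : Cc setT (F k).
  apply: (Cc_sub (CcT GC)).
    by apply: continuous_minr; [exact: GC.1 | exact: (discrete_density_Cc _ pC).1].
  move=> x Gx; rewrite /F Gx min_l //; apply: discrete_density_ge0 => //; exact: mesh_gt0.
have F0 k x : 0 <= F k x.
  by rewrite le_min G0 /=; apply: discrete_density_ge0 => //; exact: mesh_gt0.
apply: (hL psi (fun k => I (F k))) => //; last first.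
  move=> k; apply: (le_lebesgue_integral lamP) => //; first exact: CcT (discrete_density_Cc _ pC).
  by move=> x; rewrite ge_min lexx orbT.
apply: (dominated_cvg_Cc lamP (g := G)) => //; [exact: CcT GC|exact: CcT GC| |]; last first.
  by move=> k x; rewrite ger0_norm // ge_min lexx.
move=> x; have [px|px] := eqVneq (psi x) 0.
  rewrite (_ : (fun _ => _) = (fun=> G x)); first exact: cvg_cst.
  apply/funext => k; rewrite /F min_l // /G px mul0r.
  by apply: discrete_density_ge0 => //; exact: mesh_gt0.
have xO : Om x.
  by apply: contrapT => xn; move/eqP: px; apply; case: pC => _ [K [_ KO K0]]; apply: K0 => /KO.
have pp : 0 < psi x by rewrite lt_def px p0.
apply/cvgrPdist_le => e e0.
(* The tolerance is divided by [psi x] because the estimate is multiplied by [psi x] afterwards. *)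
have [del del0 hd] := hc x (e / psi x) xO (divr_gt0 e0 pp).
near=> k.
have sk : mesh k < del by near: k; exact: near_mesh.
have := hd (mesh k); rewrite mesh_gt0 sk => /(_ isT) h.
have FG : F k x <= G x by rewrite ge_min lexx.
rewrite ger0_norm ?subr_ge0 // lerBlDr -lerBlDl le_min; apply/andP; split; first by rewrite gerBl ltW.
rewrite lerBlDr; have A0 := discrete_density_ge0 x (mesh_gt0 k) pC p0.
rewrite {1}/G /curv_density maxr_pMr // mulr0 ge_max addr_ge0 ?(ltW e0) //=.
rewrite /discrete_density; have : psi x * dlap (mesh k) d x <= e - psi x * c.
  have := ler_wpM2l (p0 x) h; rewrite mulrBr [psi x * (e / psi x)]mulrC divfK //.
by rewrite mulrDr mulrCA; lra.
Unshelve. all: by end_near. Qed.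

End DistanceFunctional.

(** * The measures and their Lebesgue decomposition *)

Section DensityMeasure.
Context {dsp : measure_display} {T : measurableType dsp} {R : realType}.
Variables (mu : {measure set T -> \bar R}) (rho : T -> R).
Hypotheses (mrho : measurable_fun setT rho) (rho0 : forall x, 0 <= rho x).

Definition density_measure (A : set T) : \bar R := (\int[mu]_(x in A) (rho x)%:E)%E.

Let density0 : density_measure set0 = 0%E.
Proof. exact: integral_set0. Qed.

Let density_ge0 A : (0 <= density_measure A)%E.
Proof. by apply: integral_ge0 => x _; rewrite lee_fin. Qed.

Let density_sigma_additive : semi_sigma_additive density_measure.
Proof.
move=> F mF tF mUF; rewrite /density_measure ge0_integral_bigcup //.
- by apply: is_cvg_nneseries => k _ _; exact: density_ge0.
- by apply/measurable_EFinP; exact: measurable_funS mrho.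
- by move=> x _; rewrite lee_fin.
Qed.

HB.instance Definition _ := isMeasure.Build _ T R density_measure
  density0 density_ge0 density_sigma_additive.

Lemma ex_density_measure : exists m : {measure set T -> \bar R},
  forall A, m A = (\int[mu]_(x in A) (rho x)%:E)%E.
Proof. by exists density_measure. Qed.

End DensityMeasure.

(** * The measure [(n / d) dx] and the lower bound for the Riesz measure *)

Section DistanceMeasures.
Context {R : realType} {n : nat}.
Local Notation V := 'rV[R]_n.
Implicit Types (f g phi psi chi : V -> R) (x y z u v : V).
Variable Om : set V.
Hypotheses (oOm : open Om) (nOm : ~` Om !=set0).
Variable lam : {measure set (Rn R n) -> \bar R}.
Hypothesis lamP : is_lebesgue lam.
Local Notation I := (Rintegral lam setT).
Local Notation d := (distc Om).

Definition rho x : R := n%:R / d x.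

Lemma rho_ge0 x : 0 <= rho x.
Proof. by rewrite divr_ge0 // distc_ge0. Qed.

Lemma rho_out x : ~ Om x -> rho x = 0.
Proof. by move=> xO; rewrite /rho distc_out // invr0 mulr0. Qed.

Lemma measurable_rho : measurable_fun setT (rho : Rn R n -> R).
Proof.
have mOm := measurable_open oOm.
have cr x : Om x -> {for x, continuous rho}.
  move=> xO; apply: (@continuousM R V (fun=> n%:R) (fun x => (d x)^-1)).
    exact: cst_continuous.
  apply: continuousV; last exact: distc_continuous.
  by rewrite gt_eqF // distc_gt0.
have -> : rho = (rho : Rn R n -> R) \_ (Om : set (Rn R n)).
  apply/funext => x; rewrite /patch; case: ifPn => // /negP xO.
  by rewrite rho_out // => h; apply: xO; rewrite inE.
apply/(measurable_restrictT _ _).1 => //.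
apply: (measurability _ (measurable_realfun.RGenOpens.measurableE R)) => _ [_ [a [b ->]] <-].
apply: measurable_open; rewrite openE => x [xO xab]; rewrite /interior.
have h1 : nbhs (x : V) Om by exact: open_nbhs_nbhs.
have h2 : nbhs (x : V) (rho @^-1` `]a, b[%classic).
  by apply: (cr x xO); apply: open_nbhs_nbhs; split => //; exact: interval_open.
exact: (@filterI _ (nbhs (x : V)) _ _ _ h1 h2).
Qed.

Lemma rho_Cc psi : Cc Om psi -> Cc Om (fun x => psi x * rho x).
Proof.
move=> pC; rewrite (_ : (fun _ => _) = (fun x => n%:R * (psi x / d x))).
  by apply: CcZ; exact: Cc_div.
by apply/funext => x; rewrite /rho mulrCA.
Qed.

Lemma integral_rho psi : Cc Om psi -> I (fun x => psi x * rho x) = n%:R * I (fun x => psi x / d x).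
Proof.
move=> pC; have [_ IZ _] := lebesgue_positive_linear lamP.
rewrite -IZ; last exact: CcT (Cc_div oOm nOm pC).
by congr Rintegral; apply/funext => x; rewrite /rho mulrCA.
Qed.

Lemma lebesgue_integral_EFin f : Cc setT f -> (\int[lam]_x (f x)%:E)%E = (I f)%:E.
Proof.
by move=> fC; rewrite /Rintegral fineK // integrable_fin_num //; exact: lebesgue_integrable.
Qed.

Lemma restrict_integral_le (A : set V) (gam : V -> R) psi :
  measurable (A : set (Rn R n)) -> measurable_fun setT (gam : Rn R n -> R) ->
  (forall x, 0 <= gam x) ->
  (forall x, 0 <= psi x) -> (forall x, A x -> 1 <= psi x) ->
  Cc setT (fun x => psi x * gam x) ->
  (\int[lam]_(x in (A : set (Rn R n))) (gam x)%:E <= (I (fun x => psi x * gam x))%:E)%E.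
Proof.
move=> mA mg g0 p0 p1 pg; rewrite -lebesgue_integral_EFin // integral_mkcond.
apply: ge0_le_integral => //.
- by move=> x _; rewrite /patch; case: ifP => // _; rewrite lee_fin.
- apply/(measurable_restrictT _ _).1 => //; apply/measurable_EFinP.
  exact: measurable_funS mg.
- by apply/measurable_EFinP; apply: measurable_continuous; case: pg.
- move=> x _; rewrite /patch; case: ifPn => [|_]; rewrite lee_fin.
    by rewrite inE => /p1 h; rewrite ler_peMl.
  by rewrite mulr_ge0.
Qed.

Variable mum : {measure set (Rn R n) -> \bar R}.
Hypothesis mumE : forall A, mum A = (\int[lam]_(x in A) (rho x)%:E)%E.

Lemma density_loc_finite : loc_finite_on Om mum.
Proof.
split.
  rewrite mumE; apply: integral0_eq => x xO; congr EFin; exact: rho_out.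
move=> K cK KO; have [chi [_ [cC chi01 chi1 _ _]]] := cutoff oOm nOm cK KO.
rewrite mumE; apply: le_lt_trans (restrict_integral_le (psi := chi) _ measurable_rho rho_ge0 _ _ _) (ltry _).
- exact: measurable_compact.
- by move=> x; case/andP: (chi01 x).
- by move=> x /chi1 ->.
- exact: CcT (rho_Cc cC).
Qed.

(** The integral against [mum] is identified as in the Riesz theorem: both functionals are pinned by
    the mass that [mum] gives to open sets. *)
Lemma density_sandwiched : sandwiched Om mum (fun psi => I (fun x => psi x * rho x)).
Proof.
have [ID IZ I0] := lebesgue_positive_linear lamP.
split.
- split.
  + move=> f g fC gC; rewrite -ID; [|exact: CcT (rho_Cc fC)|exact: CcT (rho_Cc gC)].
    by congr Rintegral; apply/funext => x; rewrite mulrDl.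
  + move=> c f fC; rewrite -IZ; last exact: CcT (rho_Cc fC).
    by congr Rintegral; apply/funext => x; rewrite mulrA.
  + move=> f fC f0; apply: I0; first exact: CcT (rho_Cc fC).
    by move=> x; rewrite mulr_ge0 // rho_ge0.
- move=> U f oU [fC f01 fU]; have mU := measurable_open oU.
  have rC := CcT (rho_Cc fC).
  rewrite mumE -lebesgue_integral_EFin // [leRHS]integral_mkcond.
  apply: ge0_le_integral => //.
  + by move=> x _; rewrite lee_fin mulr_ge0 ?rho_ge0 //; case/andP: (f01 x).
  + by apply/measurable_EFinP; apply: measurable_continuous; case: rC.
  + apply/(measurable_restrictT _ _).1 => //; apply/measurable_EFinP.
    exact: measurable_funS measurable_rho.
  + move=> x _; rewrite /patch; case: ifPn => [_|/negP xU]; rewrite lee_fin.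
      by case/andP: (f01 x) => f0 f1; rewrite ler_piMl // rho_ge0.
    by rewrite fU ?mul0r // => h; apply: xU; rewrite inE.
- move=> U f oU fC f0 f1; rewrite mumE.
  apply: (restrict_integral_le _ measurable_rho rho_ge0) => //.
    exact: measurable_open.
  exact: CcT (rho_Cc fC).
Qed.

Lemma density_integral psi : Cc Om psi ->
  (\int[mum]_x (psi x)%:E)%E = (n%:R * I (fun x => psi x / d x))%:E.
Proof.
move=> pC; have [_ mfin] := density_loc_finite.
rewrite (Cc_integral_EFin mfin) // -integral_rho //; congr EFin.
exact: (sandwiched_eq oOm nOm (sandwiched_integral mfin) density_sandwiched pC).
Qed.

Variables (L : (V -> R) -> R) (mup : {measure set (Rn R n) -> \bar R}).
Hypothesis Lp : positive_linear Om L.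
Hypothesis mupE : forall A, mup A = mext Om L A.
Variable c : R.
Hypothesis Lc : forall psi, Cc Om psi -> (forall x, 0 <= psi x) ->
  I (fun x => psi x * curv_density Om c x) <= L psi.
Local Notation gam := (curv_density Om c).

Lemma measurable_curv_density : measurable_fun setT (gam : Rn R n -> R).
Proof.
apply: measurable_maxr; first exact: measurable_cst.
by apply: measurable_funD; [exact: measurable_rho | exact: measurable_cst].
Qed.

Lemma curv_density_ge0 x : 0 <= gam x.
Proof. by rewrite le_max lexx. Qed.

(** The hypothesis on [L] concerns functions, the conclusion Borel sets. For each open [U] covering
    [A], the functions [chi min(1, k d_W)] compete for the mass of [U] and equal 1 on [F k]; these
    sets increase to [A], and monotone convergence concludes. The factor [chi] supplies the compact
    support. *)
Lemma riesz_measure_ge (A : set (Rn R n)) (K : set V) : measurable A ->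
  compact K -> K `<=` Om -> A `<=` K ->
  (\int[lam]_(x in A) (gam x)%:E <= mup A)%E.
Proof.
move=> mA cK KO AK.
have [chi [_ [cC chi01 chi1 _ _]]] := cutoff oOm nOm cK KO.
rewrite mupE; apply: le_ereal_inf_tmp => _ [U [oU AU] <-].
pose W := U `&` Om; have oW : open W by exact: openI.
have nW : ~` W !=set0 by case: nOm => y yO; exists y => -[_ /yO].
pose F k : set (Rn R n) := A `&` [set x | 1 < k%:R * distc W x].
have oF k : open [set x | 1 < k%:R * distc W x].
  apply: open_superlevel; apply: continuous_mulr; first exact: continuous_cst.
  exact: distc_continuous.
have mF k : measurable (F k) by apply: measurableI => //; exact: measurable_open.
have FA : \bigcup_k F k = A.
  apply/seteqP; split => [x [k _ []]//|x xA].
  have xO : Om x by apply: KO; exact: AK.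
  have xW : W x by split => //; exact: AU.
  have dx := distc_gt0 nW oW xW.
  exists (Num.bound (distc W x)^-1) => //; split => //=.
  rewrite -ltr_pdivrMr // div1r; apply: archi_boundP.
  by rewrite invr_ge0 ltW.
have cvgF : (\int[lam]_(x in F k) (gam x)%:E)%E @[k --> \oo] -->
    (\int[lam]_(x in A) (gam x)%:E)%E.
  rewrite -FA; apply: ge0_nondecreasing_set_cvg_integral => //.
  - move=> k l kl; apply/subsetPset => x [xA /= h]; split => //=.
    by apply: lt_le_trans h _; rewrite ler_wpM2r ?distc_ge0 // ler_nat.
  - by move=> k; apply/measurable_EFinP; exact: measurable_funS measurable_curv_density.
  - by move=> k x _; rewrite lee_fin curv_density_ge0.
apply: (cvge_le _ cvgF); apply: nearW => k.
pose psi x := chi x * Num.min 1 (k%:R * distc W x).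
have m0 x : 0 <= Num.min 1 (k%:R * distc W x).
  by rewrite le_min ler01 mulr_ge0 // distc_ge0.
have cm : continuous (fun x => Num.min 1 (k%:R * distc W x)).
  apply: continuous_minr; first exact: continuous_cst.
  by apply: continuous_mulr; [exact: continuous_cst | exact: distc_continuous].
have pC : Cc Om psi by exact: CcM.
have p0 x : 0 <= psi x by rewrite mulr_ge0 //; case/andP: (chi01 x).
apply: (@le_trans _ _ (I (fun x => psi x * gam x))%:E).
  apply: restrict_integral_le => //.
  - exact: measurable_curv_density.
  - exact: curv_density_ge0.
  - by move=> x [/AK /chi1 xA /= h]; rewrite /psi xA mul1r min_l // ltW.
  - exact: CcT (curv_density_Cc oOm nOm c pC p0).
apply: (@le_trans _ _ (L psi)%:E); first by rewrite lee_fin Lc.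
apply: le_mopen; split => // x.
  rewrite p0 /=; case/andP: (chi01 x) => h0 h1.
  by rewrite /psi mulr_ile1 // ge_min lexx.
move=> xU; rewrite /psi (@distc_out _ _ W) ?mulr0 ?min_r ?ler01 ?mulr0 //.
by move=> [/xU].
Qed.

End DistanceMeasures.

(** * Consequences for an arbitrary Lebesgue decomposition *)

Section Decomposition.
Context {R : realType} {n : nat}.
Local Notation V := 'rV[R]_n.
Local Notation T := (Rn R n).
Implicit Types (x y z : V).
Variable Om : set V.
Hypotheses (oOm : open Om) (nOm : ~` Om !=set0).
Variables (lam mup mum sp sm : {measure set T -> \bar R}).
Hypothesis lamP : is_lebesgue lam.
Hypothesis mumE : forall A, mum A = (\int[lam]_(x in A) (rho Om x)%:E)%E.
Hypotheses (mup_fin : loc_finite_on Om mup) (mum_fin : loc_finite_on Om mum).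
Hypotheses (sp_fin : loc_finite_on Om sp) (sm_fin : loc_finite_on Om sm).
Hypotheses (sp_sing : singular_wrt sp lam) (sm_sing : singular_wrt sm lam).
Variable f : T -> R.
Hypothesis f_int : forall K : set V, compact K -> K `<=` Om ->
  lam.-integrable (K : set T) (EFin \o f).
Hypothesis decomposition : forall A, rc_borel Om A ->
  (mup A - mum A = \int[lam]_(x in A) (f x)%:E + sp A - sm A)%E.

Lemma common_null_set : exists N : set T,
  [/\ measurable N, lam N = 0%E, sp (~` N) = 0%E & sm (~` N) = 0%E].
Proof.
have [N1 [mN1 l1 s1]] := sp_sing; have [N2 [mN2 l2 s2]] := sm_sing.
exists (N1 `|` N2); split.
- exact: measurableU.
- apply: (@measure_negligible _ _ _ lam); first exact: measurableU.
  by apply: negligibleU; [exists N1; split | exists N2; split].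
- apply: (subset_measure0 _ _ _ s1); [| exact: measurableC|].
    by apply: measurableC; exact: measurableU.
  by move=> x xN h; apply: xN; left.
- apply: (subset_measure0 _ _ _ s2); [| exact: measurableC|].
    by apply: measurableC; exact: measurableU.
  by move=> x xN h; apply: xN; right.
Qed.

Lemma rc_borel_fin_num (m : {measure set T -> \bar R}) A :
  loc_finite_on Om m -> rc_borel Om A -> m A \is a fin_num.
Proof.
move=> [_ mfin] [mA [K [cK KO AK]]]; rewrite ge0_fin_numE //.
apply: le_lt_trans (mfin K cK KO); apply: le_measure; rewrite ?inE //.
exact: measurable_compact.
Qed.

Lemma rc_borel_sub (A B : set T) : rc_borel Om B -> measurable A -> A `<=` B -> rc_borel Om A.
Proof.
by move=> [mB [K [cK KO BK]]] mA AB; split => //; exists K; split => // x /AB /BK.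
Qed.

Lemma rc_borel_integrable (A : set T) : rc_borel Om A -> lam.-integrable A (EFin \o f).
Proof.
move=> [mA [K [cK KO AK]]]; apply: integrableS (f_int cK KO) => //.
exact: measurable_compact.
Qed.

(** Intersecting [A] with the common null set removes [f dx] and [mum] but nothing of [sp] and [sm],
    so what remains of [sp A - sm A] is a value of [mup]. *)
Lemma singular_part_ge0 (A : set T) : rc_borel Om A -> (sm A <= sp A)%E.
Proof.
move=> rA; have [mA _] := rA; have [N [mN lN pN qN]] := common_null_set.
have mAN : measurable (A `&` N) by exact: measurableI.
have rAN : rc_borel Om (A `&` N) by exact: rc_borel_sub rA mAN _.
have lAN : lam (A `&` N) = 0%E by exact: (subset_measure0 mAN mN _ lN).
have conc (s : {measure set T -> \bar R}) : s (~` N) = 0%E -> s A = s (A `&` N).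
  move=> sN; rewrite (measureDI s mA mN) [X in (X + _)%E](_ : _ = 0%E) ?add0e //.
  by apply: (subset_measure0 _ _ _ sN) => //; [exact: measurableD | exact: measurableC].
have [mf _] := integrableP _ _ _ (rc_borel_integrable rAN).
have := decomposition rAN.
rewrite (null_set_integral mAN mf lAN) add0e mumE null_set_integral //; last first.
  by apply/measurable_EFinP; apply: measurable_funS (measurable_rho oOm nOm).
rewrite sube0 (conc sp pN) (conc sm qN) => h.
rewrite -sube_ge0; last by rewrite (rc_borel_fin_num sm_fin rAN).
by rewrite -h measure_ge0.
Qed.

Variable c : R.
Hypothesis mup_lower : forall A : set T, rc_borel Om A ->
  (\int[lam]_(x in A) (curv_density Om c x)%:E <= mup A)%E.

(** On the set [A] where [f < c], stripped of the null set carrying [sp] and [sm], the decomposition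
    reads [mup A - mum A = \int_A f]. Since the curvature density is at least [rho + c], the left
    side is at least [c lam(A)]. The positive function [c - f] then has zero integral over [A],
    which forces [lam A = 0]. *)
Lemma density_below_null (K : set V) : compact K -> K `<=` Om ->
  lam.-negligible ((K : set T) `&` [set x | f x < c]).
Proof.
move=> cK KO; have [N [mN lN pN qN]] := common_null_set.
have mK := measurable_compact cK.
have fK := f_int cK KO.
pose E0 : set T := (K : set T) `&` [set x | ((EFin \o f) x < c%:E)%E].
have mE0 : measurable E0 by apply: emeasurable_fun_infty_o => //; case/integrableP: fK.
pose A := E0 `\` N.
have mA : measurable A by exact: measurableD.
have AK : A `<=` K by move=> x [[]].
have rA : rc_borel Om A by split => //; exists K.
have Afc x : A x -> f x < c by move=> [[_ /=]]; rewrite lte_fin.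
suff lA : lam A = 0%E.
  apply: (@negligibleS _ _ _ lam (A `|` N)).
    move=> x [xK xf]; have [xN|xN] := pselect (N x); [by right | left; split => //].
  by apply: negligibleU; [exists A; split|exists N; split].
have conc (s : {measure set T -> \bar R}) : s (~` N) = 0%E -> s A = 0%E.
  move=> sN; apply: (subset_measure0 _ _ _ sN) => //; first exact: measurableC.
  by move=> x [].
have fi := rc_borel_integrable rA.
have lamA : (lam A < +oo)%E.
  apply: le_lt_trans (lebesgue_compact_fin lamP cK).
  by apply: le_measure; rewrite ?inE.
have cst_int r : lam.-integrable A (EFin \o cst r).
  apply: measurable_bounded_integrable => //; exists `|r|; split; first exact: num_real.
  by move=> M rM x _; exact: ltW.
have ci := cst_int c.
have mumA := rc_borel_fin_num mum_fin rA.
have ri : lam.-integrable A (EFin \o rho Om).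
  apply/integrableP; split.
    by apply/measurable_EFinP; apply: measurable_funS (measurable_rho oOm nOm).
  have := mumA; rewrite ge0_fin_numE // mumE; congr (_ < _)%E.
  by apply: eq_integral => x _ /=; rewrite ger0_norm // rho_ge0.
have mumR : mum A = (Rintegral lam A (rho Om))%:E.
  by rewrite /Rintegral -mumE fineK.
have fR : (\int[lam]_(x in A) (f x)%:E)%E = (Rintegral lam A f)%:E.
  by rewrite /Rintegral fineK // integrable_fin_num.
have cR : Rintegral lam A (cst c) = c * fine (lam A) by rewrite Rintegral_cst.
have low : ((Rintegral lam A (rho Om) + c * fine (lam A))%:E <= mup A)%E.
  rewrite -cR -RintegralD //; apply: le_trans (mup_lower rA).
  rewrite /Rintegral fineK; last first.
    apply: integrable_fin_num => //; exact: (integrableD mA ri ci).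
  apply: le_integral => //.
  - exact: (integrableD mA ri ci).
  - apply: (@le_integrable _ _ _ _ A _ _ (EFin \o (fun x => rho Om x + `|c|))) => //.
    + by apply/measurable_EFinP; apply: measurable_funS (measurable_curv_density oOm nOm c).
    + move=> x _ /=.
      have rc0 : 0 <= rho Om x + `|c| by rewrite addr_ge0 ?rho_ge0.
      rewrite lee_fin (ger0_norm rc0) ger0_norm ?curv_density_ge0 //.
      by rewrite /curv_density ge_max rc0 lerD2l ler_norm.
    + exact: (integrableD mA ri (cst_int `|c|)).
  - by move=> x _; rewrite lee_fin /curv_density le_max lexx orbT.
have key : c * fine (lam A) <= Rintegral lam A f.
  have := decomposition rA; rewrite (conc sp pN) (conc sm qN) adde0 sube0 fR mumR.
  move: low; case: (mup A) (rc_borel_fin_num mup_fin rA) => // a _.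
  by rewrite lee_fin => low; rewrite -EFinB => -[]; lra.
have zero : (\int[lam]_(x in A) `|(c - f x)%:E|)%E = 0%E.
  have di : lam.-integrable A (EFin \o (fun x => c - f x)) by exact: (integrableB mA ci fi).
  have -> : (\int[lam]_(x in A) `|(c - f x)%:E|)%E = (\int[lam]_(x in A) (c - f x)%:E)%E.
    apply: eq_integral => x; rewrite inE => /Afc xf /=.
    by rewrite ger0_norm // subr_ge0 ltW.
  have -> : (\int[lam]_(x in A) (c - f x)%:E)%E = (Rintegral lam A (fun x => c - f x))%:E.
    by rewrite /Rintegral fineK // integrable_fin_num.
  congr EFin; apply/eqP; rewrite eq_le; apply/andP; split.
    by rewrite RintegralB // cR subr_le0.
  by apply: Rintegral_ge0 => x /Afc xf; rewrite subr_ge0 ltW.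
have md : measurable_fun A (EFin \o (fun x => c - f x)).
  by have /integrableP[] := integrableB mA ci fi.
have [B [mB lB AB]] := (ae_eq_integral_abs lam mA md).1 zero.
apply: (subset_measure0 mA mB _ lB) => x xA; apply: AB => /= /(_ xA) [].
by move/eqP; rewrite subr_eq0 => /eqP h; have := Afc x xA; rewrite h ltxx.
Qed.

(** Integrability of [f] is local, so [Om] is exhausted by countably many compact sets, bounded and
    at positive distance from the complement. *)
Lemma density_ge_ae : {ae lam, forall x : T, Om x -> c <= f x}.
Proof.
pose K (k : nat) : set V := [set x | k.+1%:R^-1 <= distc Om x /\ enorm x <= k%:R].
have cK k : compact (K k).
  apply: (@bounded_compact _ _ _ k%:R); last by move=> x [].
  apply: closedI.
    apply: (@closed_comp _ _ (distc Om) [set s | k.+1%:R^-1 <= s]) => [x _|].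
      exact: distc_continuous.
    exact: closed_ge.
  apply: (@closed_comp _ _ (@enorm R n) [set s | s <= k%:R]) => [x _|].
    exact: enorm_continuous.
  exact: closed_le.
have KO k : K k `<=` Om.
  move=> x [h _]; apply: distc_gt0E => //; apply: lt_le_trans h.
  by rewrite invr_gt0.
apply: (@negligibleS _ _ _ lam (\bigcup_k ((K k : set T) `&` [set x | f x < c]))).
  move=> x /= /not_implyP[xO /negP]; rewrite -ltNge => xf.
  have dx := distc_gt0 nOm oOm xO.
  pose k := maxn (Num.bound (distc Om x)^-1) (Num.bound (enorm x)).
  exists k => //; split => //; split.
    rewrite -[leRHS]invrK lef_pV2 ?posrE ?invr_gt0 //.
    have h : (distc Om x)^-1 < (Num.bound (distc Om x)^-1)%:R.
      by apply: archi_boundP; rewrite invr_ge0 ltW.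
    by apply: ltW; apply: lt_le_trans h _; rewrite ler_nat (leq_trans (leq_maxl _ _) (leqnSn _)).
  have h : enorm x < (Num.bound (enorm x))%:R by apply: archi_boundP; exact: enorm_ge0.
  by apply: ltW; apply: lt_le_trans h _; rewrite ler_nat leq_maxr.
by apply: negligible_bigcup => k; apply: density_below_null.
Qed.

End Decomposition.

(** This keeps the infimum of the curvatures from being taken over the empty set, where its value
    would be [+oo]. *)
Lemma exists_mean_curv (R : realType) (n : nat) (Om : set 'rV[R]_n) :
  open Om -> Om !=set0 -> ~` Om !=set0 -> C2_boundary Om ->
  exists2 y, bdry Om y & exists H, is_mean_curv Om y H.
Proof.
move=> oO [x xO] nO C2O; have [y yO dxy] := distc_attained nO oO x.
have yb := nearest_bdry nO oO xO yO dxy; exists y => //.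
by have [r [psi ld]] := C2O y yb; exists (mean_curv_formula psi y), r, psi.
Qed.

Lemma inf_mean_curv_le (R : realType) (n : nat) (Om : set 'rV[R]_n) y (H h : R) :
  inf_mean_curv Om = h%:E -> bdry Om y -> is_mean_curv Om y H -> h <= H.
Proof.
move=> hE yb yH; rewrite -lee_fin -hE; apply: ereal_inf_lbound.
by exists H => //; exists y.
Qed.

(** Both [mup] and [mum] may be infinite near the boundary, so their difference is evaluated only on
    relatively compact Borel subsets. The conclusion covers every decomposition of that form, the
    singular part being again a difference of two locally finite measures. *)
Theorem theorem3p4 (R : realType) (n : nat) (Om : set 'rV[R]_n)
  (lam : {measure set (Rn R n) -> \bar R}) :
  (2 <= n)%N -> is_lebesgue lam ->
  domain Om -> ~` Om !=set0 ->
  C2_boundary Om -> uniform_interior_sphere Om ->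
  (* mu := -Delta d is a signed Radon measure on Om, mu = mup - mum *)
  exists mup mum : {measure set (Rn R n) -> \bar R},
    [/\ loc_finite_on Om mup, loc_finite_on Om mum,
      (forall phi, test_fun Om phi ->
         (- (\int[lam]_x (distc Om x * laplacian phi x)%:E)
          = \int[mup]_x (phi x)%:E - \int[mum]_x (phi x)%:E)%E) &
      (* for the Lebesgue decomposition mu = f dx + (sp - sm), sp - sm singular *)
      forall (f : Rn R n -> R) (sp sm : {measure set (Rn R n) -> \bar R}),
        (forall K : set 'rV[R]_n, compact K -> K `<=` Om ->
           lam.-integrable (K : set (Rn R n)) (EFin \o f)) ->
        loc_finite_on Om sp -> loc_finite_on Om sm ->
        singular_wrt sp lam -> singular_wrt sm lam ->
        (forall A, rc_borel Om A ->
           (mup A - mum A = \int[lam]_(x in A) (f x)%:E + sp A - sm A)%E) ->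
        (forall A, rc_borel Om A -> (sm A <= sp A)%E) /\
        {ae lam, forall x : Rn R n, Om x ->
           ((n.-1)%:R%:E * inf_mean_curv Om <= (f x)%:E)%E}].
Proof.
move=> n2 lamP [oO _ neO] nO C2O _.
have [L [Lp hL]] := ex_weak_limit oO nO lamP.
have [mup mupE] := ex_riesz_measure oO nO Lp.
have [mum mumE] := ex_density_measure lam (measurable_rho oO nO) (rho_ge0 nO).
have mup_fin := riesz_loc_finite oO nO Lp mupE.
have mum_fin := density_loc_finite oO nO lamP mumE.
exists mup, mum; split => // [phi tphi|f sp sm fint spf smf sps sms dec].
  have [sphi cphi] := tphi.
  have pC : Cc Om phi by split => //; case: (sphi [::]).
  rewrite (riesz_representation oO nO Lp mupE pC) (density_integral oO nO lamP mumE pC).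
  have lim := discrete_density_test oO nO lamP tphi.
  have LE : L phi = n%:R * Rintegral lam setT (fun x => phi x / distc Om x) -
      Rintegral lam setT (fun x => distc Om x * laplacian phi x).
    apply/eqP; rewrite eq_le; apply/andP; split; last by apply: hL lim _.
    have [_ LZ _] := Lp.
    (* The limit property of [L] gives lower bounds only; the upper bound results from applying it
       to [- phi]. *)
    rewrite -lerN2 -[leRHS]mulN1r -LZ //; apply: (hL _ _ _ (CcZ (-1) pC) (cvgN lim)) => k.
    have [_ AZ _] := discrete_density_linear oO nO lamP (mesh_gt0 k).
    by rewrite AZ // mulN1r.
  have [r r0 pr] := Cc_ball pC.
  have dl : Cc setT (fun x => distc Om x * laplacian phi x).
    have := CcM (laplacian_Cc sphi pr) (distc_continuous nO).
    by congr Cc; apply/funext => x; rewrite mulrC.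
  rewrite (lebesgue_integral_EFin lamP dl) LE -EFinB -EFinN; congr EFin; ring.
split; first by move=> A rA; apply: (singular_part_ge0 oO nO mumE smf sps sms fint dec).
have [y yb [H yH]] := exists_mean_curv oO neO nO C2O.
have infy : (inf_mean_curv Om <= H%:E)%E.
  by apply: ereal_inf_lbound; exists H => //; exists y.
have n10 : 0 < (n.-1)%:R :> R by rewrite ltr0n -subn1 subn_gt0.
(* A finite infimum supplies the constant [c = (n - 1) h]; [+oo] is excluded by the boundary point
   just found; for [-oo] the claim is trivial because [n - 1] is positive. *)
case hE : (inf_mean_curv Om) infy => [h| |] infy.
- have low (A : set (Rn R n)) : rc_borel Om A ->
      (\int[lam]_(x in A) (curv_density Om ((n.-1)%:R * h) x)%:E <= mup A)%E.
    move=> [mA [K [cK KO AK]]]; apply: (riesz_measure_ge oO nO lamP mupE _ mA cK KO AK).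
    move=> psi pC p0; apply: (weak_limit_ge oO nO lamP hL) => // x eps xO eps0.
    apply: dlap_distc_near => // z H' zb zH.
    by rewrite ler_wpM2l ?(ltW n10) // (inf_mean_curv_le hE zb zH).
  have ae := density_ge_ae oO nO lamP mumE mup_fin mum_fin sps sms fint dec low.
  apply: filterS ae => x h' xO; rewrite -EFinM lee_fin; exact: h'.
- by move: infy; rewrite leye_eq.
- by apply: aeW => x _; rewrite mulr_infty gtr0_sg // mul1e leNye.
Qed.
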